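(* Let $\rho_{ABC}$ be a state on finite-dimensional systems $A,B,C$, with $d_B=\dim\mathcal{H}_B$. Define $\Delta(\rho)=\inf D(\rho\|\mu)$, the infimum over all finite-dimensional systems $\widehat A\supseteq A$, $\widehat B\supseteq B$, $\widehat C\supseteq C$ (isometric embeddings, $\rho$ regarded as a state on $\widehat A\widehat B\widehat C$) and all quantum Markov states $\mu$ on $\widehat A\widehat B\widehat C$. Then this infimum is attained at a Markov state on $A\widehat{B}C$ (with $A$, $C$ unenlarged) for some embedding $B\hookrightarrow\widehat B$ whose decomposition is $\widehat{B}=\bigoplus_{j=1}^{k}b_j^L\otimes b_j^R$ with $k\le d_B^2$ and $\dim b_j^L,\dim b_j^R\le d_B$ for all $j$. In particular the infimum is a minimum, and for fixed dimensions $d_A,d_B,d_C$, $\Delta$ is a continuous function of $\rho$.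
   Context: A quantum Markov state on a tripartite system $XYZ$ is a state $\mu_{XYZ}$ for which there exist an orthogonal direct sum decomposition $\mathcal H_Y=\bigoplus_j b_j^L\otimes b_j^R$, a probability distribution $(p_j)$ and states $\mu^{(j)}_{Xb_j^L}$, $\mu^{(j)}_{b_j^RZ}$ such that $\mu_{XYZ}=\bigoplus_j p_j\,\mu^{(j)}_{Xb_j^L}\otimes\mu^{(j)}_{b_j^RZ}$. $D(\rho\|\mu)=\operatorname{tr}\rho(\log\rho-\log\mu)$ is the quantum relative entropy. *)

(* Defs.v *)
From HB Require Import structures.
From mathcomp Require Import all_boot all_order all_algebra.
From mathcomp Require Import boolp classical_sets reals ereal exp.
From mathcomp Require Import complex mxtens.
From mathcomp Require spectral.

Set Implicit Arguments.
Unset Strict Implicit.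
Unset Printing Implicit Defensive.

Import Order.TTheory GRing.Theory Num.Theory Num.Def.
Local Open Scope ring_scope.
Local Open Scope complex_scope.

Section QInfo.
Variable R : realType.
Local Notation C := R[i].

Definition adj m n (A : 'M[C]_(m, n)) : 'M[C]_(n, m) := map_mx conjC A^T.

Definition psd n (A : 'M[C]_n) : Prop :=
  forall v : 'cV[C]_n, 0 <= (adj v *m A *m v) 0 0.
Definition density n (A : 'M[C]_n) : Prop := psd A /\ \tr A = 1.

Definition is_isometry m n (V : 'M[C]_(m, n)) : Prop := adj V *m V = 1%:M.

(* functional calculus through the spectral decomposition
   A = P^-1 diag(sp) P (P unitary) of mathcomp's spectral.v; the real part is
   taken because the eigenvalues of Hermitian matrices are real *)
Definition cfun (f : R -> R) n (A : 'M[C]_n) : 'M[C]_n :=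
  let P := spectral.spectralmx A in
  invmx P *m diag_mx (map_mx (fun z : C => (f (complex.Re z))%:C)
                             (spectral.spectral_diag A)) *m P.

(* matrix (natural) logarithm; ln 0 = 0 in mathcomp-analysis, so this is the
   logarithm on the support (the usual convention 0 log 0 = 0) *)
Definition logm n (A : 'M[C]_n) : 'M[C]_n := cfun (@ln R) A.

Definition supp_incl n (rho mu : 'M[C]_n) : Prop :=
  forall v : 'cV[C]_n, mu *m v = 0 -> rho *m v = 0.

Definition relent n (rho mu : 'M[C]_n) : \bar R :=
  if `[< supp_incl rho mu >]
  then ((complex.Re (\tr (rho *m (logm rho - logm mu)))))%:E
  else +oo%E.

(* Data of a decomposition H_Y = (+)_{j<k} b_j^L (x) b_j^R :
   block j is embedded by demb j : b_j^L (x) b_j^R -> H_Y *)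
Record decomp (dY : nat) := Decomp {
  dk : nat;
  dl : 'I_dk -> nat;
  dr : 'I_dk -> nat;
  demb : forall j : 'I_dk, 'M[C]_(dY, dl j * dr j) }.
Arguments dk {dY} d.
Arguments dl {dY} d j.
Arguments dr {dY} d j.
Arguments demb {dY} d j.

Definition orth_decomp dY (D : decomp dY) : Prop :=
  (forall j, is_isometry (demb D j)) /\
  (forall i j, i != j -> adj (demb D i) *m demb D j = 0) /\
  \sum_(j < dk D) (demb D j *m adj (demb D j)) = 1%:M.

Lemma tens_assoc_eq (a b c d : nat) : (a * b * (c * d) = a * (b * c) * d)%N.
Proof. by rewrite !mulnA. Qed.

Definition blockW dX dY dZ (D : decomp dY) (j : 'I_(dk D)) :
  'M[C]_(dX * dY * dZ, dX * (dl D j * dr D j) * dZ) :=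
  tensmx (tensmx (1%:M : 'M[C]_dX) (demb D j)) (1%:M : 'M[C]_dZ).

Definition markov_wrt dX dY dZ (D : decomp dY) (mu : 'M[C]_(dX * dY * dZ)) : Prop :=
  orth_decomp D /\
  exists (p : 'I_(dk D) -> R)
         (muL : forall j, 'M[C]_(dX * dl D j))
         (muR : forall j, 'M[C]_(dr D j * dZ)),
    (forall j, 0 <= p j) /\ \sum_(j < dk D) p j = 1 /\
    (forall j, density (muL j)) /\ (forall j, density (muR j)) /\
    mu = \sum_(j < dk D) (p j)%:C *:
           (@blockW dX dY dZ D j
              *m castmx (tens_assoc_eq _ _ _ _, tens_assoc_eq _ _ _ _)
                        (tensmx (muL j) (muR j))
              *m adj (@blockW dX dY dZ D j)).

Definition markov dX dY dZ (mu : 'M[C]_(dX * dY * dZ)) : Prop :=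
  exists D : decomp dY, markov_wrt D mu.

Definition emb3 dA dB dC dA' dB' dC'
  (VA : 'M[C]_(dA', dA)) (VB : 'M[C]_(dB', dB)) (VC : 'M[C]_(dC', dC))
  (rho : 'M[C]_(dA * dB * dC)) : 'M[C]_(dA' * dB' * dC') :=
  let W := tensmx (tensmx VA VB) VC in W *m rho *m adj W.

Definition Delta dA dB dC (rho : 'M[C]_(dA * dB * dC)) : \bar R :=
  ereal_inf [set x : \bar R | exists (dA' dB' dC' : nat)
      (VA : 'M[C]_(dA', dA)) (VB : 'M[C]_(dB', dB)) (VC : 'M[C]_(dC', dC))
      (mu : 'M[C]_(dA' * dB' * dC')),
      [/\ is_isometry VA, is_isometry VB, is_isometry VC, markov mu &
          x = relent (emb3 VA VB VC rho) mu]].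

End QInfo.

Arguments dk {R dY} d.
Arguments dl {R dY} d j.
Arguments dr {R dY} d j.
Arguments demb {R dY} d j.

(* Main.v *)
(** Write mu as the sum of p_j muL_j (x) muR_j and let M_j be the compression of
    the embedding of B to the j-th block.  By Klein's inequality the best choice
    of p_j, muL_j, muR_j is given by the weight and the marginals of the block
    S_j of rho cut out by M_j, and the relative entropy becomes
    - S(rho) + \sum_j cost (M_j), where M_j : B -> L_j (x) R_j only has to satisfy
    \sum_j M_j^* M_j = 1.  Enlarging A and C by isometries changes nothing.

    Replacing M by (1 (x) L) M with M^* (1 (x) L^* L) M = M^* M, the cost is concave in
    L^* L: one marginal of S is affine in L^* L, and the other one has the same
    spectrum as Y^* (L^* L (x) 1) Y for a fixed Y.  As in Choi's theorem on extremal
    channels, dim R > dim B leaves room to move along a line until L loses rank,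
    without increasing the cost; similarly for L_j.  A Caratheodory argument on
    the matrices M_j^* M_j, of which the cost is a concave function of the weights,
    leaves at most (dim B)^2 blocks.

    What remains is the minimum over the compact set of isometries from B to
    a fixed space of a function which is jointly continuous in rho, because
    Klein's inequality also provides a modulus of continuity of the entropy. *)
Require Import Defs.
From HB Require Import structures.
From mathcomp Require Import all_boot all_order all_algebra.
From mathcomp Require Import boolp classical_sets reals ereal exp.
From mathcomp Require Import complex mxtens.
From mathcomp Require Import topology normedtype derive.
From mathcomp Require Import spectral ring lra zify.

Set Implicit Arguments.
Unset Strict Implicit.
Unset Printing Implicit Defensive.

Import Order.TTheory GRing.Theory Num.Theory Num.Def.
Import numFieldNormedType.Exports.
Local Open Scope ring_scope.
Local Open Scope complex_scope.

(** * Adjoints and functional calculus *)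

(** The infimum ranges over unbounded dimensions, and [relent] jumps to +oo where supports fail, so
    neither compactness nor continuity applies to mu directly. Eliminating p_j, muL_j and muR_j
    removes both obstacles: the remaining cost is finite and continuous even at blocks of weight 0.
    The blocks can be optimised separately because the entropies are left unnormalised; the leftover
    terms p_j - q_j, with q_j = tr S_j, cancel in the sum, both totals being 1. Orthogonality of the
    blocks does not constrain M, since any family with the right Gram sum stacks to an isometry into
    an orthogonal direct sum.

    Shrinking a block keeps M^* M and hence q fixed, which is essential because q ln q is the one
    convex term of the cost. The bounds come from counting: M^* (1 (x) X) M = 0 and tr X = 0 are b^2
    + 1 linear equations for the r^2 entries of X, and Hermitian matrices of size b form a real
    space of dimension b^2, where b = dim B. Small and missing blocks are padded, so that one space
    of isometries serves every rho. *)

Section Adjoint.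
Variable R : realType.
Local Notation C := R[i].
Local Notation Re := (@complex.Re R).

Lemma Re_sum I (r : seq I) (P : pred I) (F : I -> C) :
  Re (\sum_(i <- r | P i) F i) = \sum_(i <- r | P i) Re (F i).
Proof. by apply: big_morph => // -[a b] [c d]. Qed.

Lemma ReD (x y : C) : Re (x + y) = Re x + Re y. Proof. by case: x; case: y. Qed.
Lemma ReN (x : C) : Re (- x) = - Re x. Proof. by case: x. Qed.
Lemma ReB (x y : C) : Re (x - y) = Re x - Re y. Proof. by rewrite ReD ReN. Qed.
Lemma ReMl (a : R) (x : C) : Re (a%:C * x) = a * Re x.
Proof. by case: x => b c; rewrite /= mul0r subr0. Qed.

Lemma psd_re (x : C) : 0 <= x -> (Re x)%:C = x.
Proof. by move=> x0; rewrite RRe_real // ger0_real. Qed.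
Lemma Re_ge0 (x : C) : 0 <= x -> 0 <= Re x.
Proof. by rewrite lecE => /andP[]. Qed.

Lemma conjC_realc (a : R) : conjC (a%:C : C) = a%:C.
Proof. by apply/CrealP; rewrite complex_real. Qed.

Section Adj.
Variables m n p : nat.
Implicit Types A B : 'M[C]_(m, n).

Lemma adjE A i j : adj A i j = conjC (A j i).
Proof. by rewrite !mxE. Qed.
Lemma adjK A : adj (adj A) = A.
Proof. exact: trmxCK. Qed.
Lemma adjM A (B : 'M[C]_(n, p)) : adj (A *m B) = adj B *m adj A.
Proof. by rewrite /adj trmx_mul map_mxM. Qed.
Lemma adjD A B : adj (A + B) = adj A + adj B.
Proof. by rewrite /adj linearD map_mxD. Qed.
Lemma adjN A : adj (- A) = - adj A.
Proof. by rewrite /adj linearN map_mxN. Qed.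
Lemma adjZ c A : adj (c *: A) = conjC c *: adj A.
Proof. by rewrite /adj linearZ map_mxZ. Qed.
Lemma adj0 : adj (0 : 'M[C]_(m, n)) = 0.
Proof. by rewrite /adj trmx0 map_mx0. Qed.
End Adj.

Lemma adj_sum m n I (r : seq I) (P : pred I) (F : I -> 'M[C]_(m, n)) :
  adj (\sum_(i <- r | P i) F i) = \sum_(i <- r | P i) adj (F i).
Proof. by apply: big_morph => [A B|]; rewrite (adj0, adjD). Qed.

Lemma adj1 n : adj (1%:M : 'M[C]_n) = 1%:M.
Proof. by rewrite /adj trmx1 map_mx1. Qed.

Lemma adj_tens m n p q (A : 'M[C]_(m, n)) (B : 'M[C]_(p, q)) :
  adj (A *t B) = adj A *t adj B.
Proof. by rewrite /adj trmx_tens map_mxT. Qed.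

Lemma adj_castmx m n m' n' (em : m = m') (en : n = n') (A : 'M[C]_(m, n)) :
  adj (castmx (em, en) A) = castmx (en, em) (adj A).
Proof. by rewrite /adj trmx_cast map_castmx. Qed.

Lemma adj_tr n (A : 'M[C]_n) : \tr (adj A) = conjC (\tr A).
Proof. by rewrite /mxtrace rmorph_sum; apply: eq_bigr => i _; rewrite adjE. Qed.

Lemma tens11 m n : (1%:M : 'M[C]_m) *t (1%:M : 'M[C]_n) = 1%:M.
Proof.
apply/matrixP => i j; case: (mxtens_indexP i) => a b; case: (mxtens_indexP j) => c d.
rewrite tensmxE !mxE (can_eq (@mxtens_indexK _ _)) xpair_eqE.
by case: eqP; case: eqP; rewrite ?(mulr0, mul0r, mulr1).
Qed.

Lemma tensDl m n p q (A B : 'M[C]_(m, n)) (E : 'M[C]_(p, q)) :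
  (A + B) *t E = A *t E + B *t E.
Proof. by apply/matrixP => i j; rewrite !mxE mulrDl. Qed.
Lemma tensDr m n p q (E : 'M[C]_(m, n)) (A B : 'M[C]_(p, q)) :
  E *t (A + B) = E *t A + E *t B.
Proof. by apply/matrixP => i j; rewrite !mxE mulrDr. Qed.
Lemma tensZl m n p q c (A : 'M[C]_(m, n)) (E : 'M[C]_(p, q)) :
  (c *: A) *t E = c *: (A *t E).
Proof. by apply/matrixP => i j; rewrite !mxE mulrA. Qed.
Lemma tensZr m n p q c (E : 'M[C]_(m, n)) (A : 'M[C]_(p, q)) :
  E *t (c *: A) = c *: (E *t A).
Proof. by apply/matrixP => i j; rewrite !mxE mulrCA. Qed.

Lemma mxtrace_adj_ge0 m n (A : 'M[C]_(m, n)) : 0 <= \tr (A *m adj A).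
Proof.
rewrite sumr_ge0 // => i _; rewrite mxE sumr_ge0 // => j _.
by rewrite adjE mul_conjC_ge0.
Qed.

Lemma mxtrace_adj_eq0 m n (A : 'M[C]_(m, n)) : \tr (A *m adj A) = 0 -> A = 0.
Proof.
have h i : 0 <= (A *m adj A) i i.
  by rewrite mxE sumr_ge0 // => j _; rewrite adjE mul_conjC_ge0.
move=> /eqP; rewrite psumr_eq0 // => /allP t0.
apply/matrixP => i j; rewrite mxE; have := t0 i; rewrite mem_index_enum => /(_ isT).
rewrite mxE psumr_eq0 => [/allP /(_ j)|k _]; last by rewrite adjE mul_conjC_ge0.
by rewrite mem_index_enum adjE mul_conjC_eq0 => /(_ isT) /eqP.
Qed.

Lemma psd_adj m n (A : 'M[C]_(m, n)) : psd (A *m adj A).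
Proof.
move=> v; rewrite -trace_mx11.
rewrite (_ : _ *m v = (adj v *m A) *m adj (adj v *m A)) ?mxtrace_adj_ge0 //.
by rewrite adjM adjK !mulmxA.
Qed.

(** Polarisation: the cross terms [q u v] and [q v u] have sum 0, and replacing [v] by ['i v] shows
    that they are also equal. *)
Lemma form_zero n (B : 'M[C]_n) :
  (forall v : 'cV[C]_n, (adj v *m B *m v) 0 0 = 0) -> B = 0.
Proof.
move=> h.
pose q (u v : 'cV[C]_n) := (adj u *m B *m v) 0 0.
have qD u v : q (u + v) (u + v) = q u u + q v v + (q u v + q v u).
  rewrite /q adjD mulmxDl mulmxDl !mulmxDr mxE mxE [in X in _ + X]mxE.
  by rewrite [X in _ + X = _]addrC addrACA.
have qe i j : q (delta_mx i 0) (delta_mx j 0) = B i j.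
  rewrite /q (_ : adj _ = delta_mx 0 i); last first.
    by apply/matrixP => a b; rewrite !mxE [a]ord1 eqxx /= andbT; case: eqP => _; rewrite ?rmorph1 ?rmorph0.
  by rewrite -rowE -colE !mxE.
have cross u v : q u v + q v u = 0.
  by have := qD u v; rewrite /q !h add0r add0r => /esym.
have qZ u v c : q u (c *: v) = c * q u v by rewrite /q -scalemxAr mxE.
have qZl u v c : q (c *: u) v = conjC c * q u v.
  by rewrite /q adjZ -!scalemxAl mxE.
apply/matrixP => i j; rewrite mxE -qe.
have h1 := cross (delta_mx i 0) (delta_mx j 0).
have := cross (delta_mx i 0) ('i%C *: delta_mx j 0).
rewrite qZ qZl (_ : conjC _ = - 'i%C); last by rewrite -conjCi.
move/eqP; rewrite mulNr -mulrBr mulf_eq0.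
have /negPf -> : ('i%C : C) != 0 by rewrite eq_complex /= oner_eq0 andbF.
move=> /= /eqP /subr0_eq e; move: h1; rewrite -e -mulr2n => /eqP.
by rewrite mulrn_eq0 /= => /eqP.
Qed.

(** In the order of [R[i]], [0 <= x] forces [x] to be real, so the form of [A - adj A] vanishes. *)
Lemma psd_herm n (A : 'M[C]_n) : psd A -> adj A = A.
Proof.
move=> pA; apply/esym/eqP; rewrite -subr_eq0; apply/eqP/form_zero => v.
rewrite mulmxBr mulmxBl mxE [X in _ + X]mxE.
have -> : adj v *m adj A *m v = adj (adj v *m A *m v).
  by rewrite !adjM adjK mulmxA.
rewrite adjE; apply/eqP; rewrite subr_eq0 eq_sym; apply/eqP.
by apply/CrealP/ger0_real/pA.
Qed.

Lemma herm_normal n (A : 'M[C]_n) : adj A = A -> A \is normalmx.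
Proof. by move=> e; apply/normalmxP; rewrite -[map_mx _ _]/(adj A) e. Qed.

Definition rdiag n (a : 'rV[R]_n) : 'M[C]_n := diag_mx (map_mx (fun x : R => x%:C) a).

Lemma adj_rdiag n (a : 'rV[R]_n) : adj (rdiag a) = rdiag a.
Proof.
apply/matrixP => i j; rewrite adjE !mxE eq_sym rmorphMn /= conjC_realc.
by case: eqP => [->|].
Qed.

(** The unitary is arbitrary, so that tensor products and rescalings of eigenbases qualify, and not
    only the basis chosen by [spectralmx]. *)
Definition eigdec n (A U : 'M[C]_n) (a : 'rV[R]_n) : Prop :=
  [/\ adj U *m U = 1%:M, U *m adj U = 1%:M & A = U *m rdiag a *m adj U].

Lemma eigdec_mulr n (A U : 'M[C]_n) a : eigdec A U a -> A *m U = U *m rdiag a.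
Proof. by case=> u1 _ ->; rewrite -mulmxA u1 mulmx1. Qed.

Lemma spectral_eigdec n (A : 'M[C]_n) : adj A = A ->
  eigdec A (adj (spectralmx A)) (map_mx Re (spectral_diag A)) /\
  map_mx (fun x : R => x%:C) (map_mx Re (spectral_diag A)) = spectral_diag A.
Proof.
move=> hA; have := spectral_unitarymx A; set P := spectralmx A => Pu.
have PP : P *m adj P = 1%:M by exact/unitarymxP.
have PP' : adj P *m P = 1%:M by exact: mulmx1C.
have ip : invmx P = adj P by exact: invmx_unitary.
have e : A = adj P *m diag_mx (spectral_diag A) *m P.
  by rewrite -ip; apply/orthomx_spectralP/herm_normal.
set d := spectral_diag A in e *.
have dd : map_mx (fun x : R => x%:C) (map_mx Re d) = d.
  have h : diag_mx d = P *m A *m adj P.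
    by rewrite e !mulmxA PP mul1mx -mulmxA PP mulmx1.
  have h2 : adj (diag_mx d) = diag_mx d by rewrite h !adjM adjK hA mulmxA.
  apply/rowP => i; rewrite !mxE RRe_real //.
  move/matrixP/(_ i i): h2; rewrite adjE !mxE eqxx mulr1n => /CrealP.
  by [].
split=> //; split; rewrite ?adjK //; first by rewrite /rdiag dd.
Qed.

Lemma herm_eigdec n (A : 'M[C]_n) : adj A = A -> exists U a, eigdec A U a.
Proof. by move=> /spectral_eigdec [h _]; exists (adj (spectralmx A)), (map_mx Re (spectral_diag A)). Qed.

Lemma cfunE f n (A : 'M[C]_n) : cfun f A =
  adj (spectralmx A) *m rdiag (map_mx f (map_mx Re (spectral_diag A))) *m spectralmx A.
Proof.
have ip : invmx (spectralmx A) = adj (spectralmx A).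
  exact: (invmx_unitary (spectral_unitarymx A)).
rewrite /cfun ip.
have -> : map_mx (fun z : C => (f (Re z))%:C) (spectral_diag A) =
    map_mx (fun x : R => x%:C) (map_mx f (map_mx Re (spectral_diag A))).
  by rewrite -!map_mx_comp.
by [].
Qed.

(* Taking B diagonal shows that cfun does not depend on the chosen spectral
   decomposition; taking W = K, A = K K^* and B = K^* K gives vnent_adjC. *)
Lemma cfun_intertwine f m n (A : 'M[C]_m) (B : 'M[C]_n) (W : 'M[C]_(m, n)) :
  adj A = A -> adj B = B -> A *m W = W *m B -> cfun f A *m W = W *m cfun f B.
Proof.
move=> /spectral_eigdec[[]]; set P := spectralmx A; set a := map_mx Re _ => P1 P2 eA _.
move=> /spectral_eigdec[[]]; set Q := spectralmx B; set b := map_mx Re _ => Q1 Q2 eB _.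
rewrite adjK in P1 P2 eA; rewrite adjK in Q1 Q2 eB.
rewrite !cfunE -/P -/Q -/a -/b => e.
have : rdiag a *m (P *m W *m adj Q) = (P *m W *m adj Q) *m rdiag b.
  rewrite -[LHS]mul1mx -{1}P1 -[RHS]mulmx1 -[X in _ = _ *m X]Q1.
  transitivity (P *m (A *m W) *m adj Q); first by rewrite eA !mulmxA.
  by rewrite e eB !mulmxA.
set Z := P *m W *m adj Q => h.
(* Entrywise, [h] says that [Z i j] is 0 or the eigenvalues [a_i] and [b_j] agree; in both cases [f]
   may be applied to them. *)
have hf : rdiag (map_mx f a) *m Z = Z *m rdiag (map_mx f b).
  apply/matrixP => i j; move/matrixP/(_ i j): h.
  rewrite !mul_diag_mx !mul_mx_diag !mxE mulrC => /eqP.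
  rewrite -subr_eq0 -mulrBr mulf_eq0 => /orP[/eqP ->|]; first by rewrite mulr0 mul0r.
  by rewrite subr_eq0 => /eqP /complexI ->; rewrite mulrC.
have -> : W = adj P *m Z *m Q.
  by rewrite /Z !mulmxA P2 mul1mx -mulmxA Q2 mulmx1.
transitivity (adj P *m (rdiag (map_mx f a) *m Z) *m Q).
  by rewrite -!mulmxA; congr (_ *m (_ *m _)); rewrite !mulmxA P1 mul1mx.
by rewrite hf -!mulmxA; congr (_ *m (_ *m _)); rewrite (mulmxA Q) Q1 mul1mx.
Qed.

Lemma eigdec_herm n (A U : 'M[C]_n) a : eigdec A U a -> adj A = A.
Proof. by case=> _ _ ->; rewrite !adjM adjK adj_rdiag mulmxA. Qed.

Lemma cfun_rdiag f n (a : 'rV[R]_n) : cfun f (rdiag a) = rdiag (map_mx f a).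
Proof.
have [U1 U2 e] := (spectral_eigdec (adj_rdiag a)).1; rewrite cfunE.
move: (spectralmx _) (map_mx Re _) U1 U2 e => P b; rewrite !adjK => P1 P2 e.
have h : rdiag b *m P = P *m rdiag a by rewrite e !mulmxA P1 mul1mx.
suff hf : rdiag (map_mx f b) *m P = P *m rdiag (map_mx f a).
  by rewrite -mulmxA hf mulmxA P2 mul1mx.
apply/matrixP => i j; move/matrixP/(_ i j): h.
rewrite !mul_diag_mx !mul_mx_diag !mxE mulrC => /eqP.
rewrite -subr_eq0 -mulrBr mulf_eq0 => /orP[/eqP ->|]; first by rewrite mulr0 mul0r.
by rewrite subr_eq0 => /eqP /complexI ->; rewrite mulrC.
Qed.

Lemma cfun_eigdec f n (A U : 'M[C]_n) a : eigdec A U a ->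
  cfun f A = U *m rdiag (map_mx f a) *m adj U.
Proof.
move=> h; have [_ u2 _] := h.
have := cfun_intertwine f (eigdec_herm h) (adj_rdiag a) (eigdec_mulr h).
by rewrite cfun_rdiag => <-; rewrite -mulmxA u2 mulmx1.
Qed.

Lemma mulmx_rdiagE m n (U : 'M[C]_(m, n)) (a : 'rV[R]_n) i j :
  (U *m rdiag a) i j = U i j * (a 0 j)%:C.
Proof. by rewrite mul_mx_diag !mxE. Qed.

(* The i-th diagonal entry of X in the orthonormal basis of the columns of U. *)
Definition diag_in n (U X : 'M[C]_n) i : R := Re ((adj U *m X *m U) i i).

Lemma tr_cfun f n (A U X : 'M[C]_n) a : eigdec A U a ->
  Re (\tr (X *m cfun f A)) = \sum_i f (a 0 i) * diag_in U X i.
Proof.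
move=> /(cfun_eigdec f) ->; rewrite !mulmxA mxtrace_mulC !mulmxA Re_sum.
by apply: eq_bigr => i _; rewrite mulmx_rdiagE mulrC ReMl; congr (_ * _); rewrite mxE.
Qed.

Lemma diag_inD n (U X Y : 'M[C]_n) i : diag_in U (X + Y) i = diag_in U X i + diag_in U Y i.
Proof. by rewrite /diag_in mulmxDr mulmxDl mxE ReD. Qed.

Lemma diag_inZ n (U X : 'M[C]_n) (c : R) i : diag_in U (c%:C *: X) i = c * diag_in U X i.
Proof. by rewrite /diag_in -scalemxAr -scalemxAl mxE ReMl. Qed.

Lemma diag_in_col n (U X : 'M[C]_n) i :
  (adj U *m X *m U) i i = (adj (col i U) *m X *m col i U) 0 0.
Proof.
rewrite [in RHS]colE adjM (_ : adj (delta_mx _ _) = delta_mx 0 i).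
  by rewrite mulmxA -colE -!mulmxA -rowE [RHS]mxE [RHS]mxE mulmxA.
apply/matrixP => a b; rewrite !mxE [a]ord1 eqxx /= andbT; case: eqP => _; by rewrite ?rmorph1 ?rmorph0.
Qed.

Lemma diag_in_ge0 n (U X : 'M[C]_n) i : psd X -> 0 <= diag_in U X i.
Proof. by move=> pX; rewrite Re_ge0 // diag_in_col; apply: pX. Qed.

Lemma diag_in_sum n (U X : 'M[C]_n) : U *m adj U = 1%:M ->
  \sum_i diag_in U X i = Re (\tr X).
Proof. by move=> u; rewrite -Re_sum -/(mxtrace _) mxtrace_mulC mulmxA u mul1mx. Qed.

Lemma psd_eigdec n (A U : 'M[C]_n) a i : psd A -> eigdec A U a -> 0 <= a 0 i.
Proof.
move=> pA [u1 _ e]; have := diag_in_ge0 U i pA.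
by rewrite /diag_in e !mulmxA u1 mul1mx -mulmxA u1 mulmx1 !mxE eqxx mulr1n.
Qed.

Lemma eigdec_diag_in n (A U : 'M[C]_n) a i : eigdec A U a -> diag_in U A i = a 0 i.
Proof.
by case=> u1 _ e; rewrite /diag_in e !mulmxA u1 mul1mx -mulmxA u1 mulmx1 !mxE eqxx mulr1n.
Qed.

Lemma psd_sqrt n (A : 'M[C]_n) : psd A -> exists Y : 'M[C]_n, A = Y *m adj Y.
Proof.
move=> pA; have [U [a h]] := herm_eigdec (psd_herm pA).
exists (U *m rdiag (map_mx sqrtr a)); case: (h) => _ _ e.
rewrite adjM adj_rdiag {1}e -!mulmxA; congr (_ *m _); rewrite mulmxA; congr (_ *m _).
rewrite mul_diag_mx; apply/matrixP => i j; rewrite !mxE.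
case: eqP => [->|]; last by rewrite !mulr0n mulr0.
rewrite !mulr1n -rmorphM; congr (_%:C).
by rewrite -expr2 sqr_sqrtr // (psd_eigdec _ pA h).
Qed.

End Adjoint.

(** * Entropy *)

Section Entropy.
Variable R : realType.
Local Notation C := R[i].
Local Notation Re := (@complex.Re R).

Lemma psdD n (A B : 'M[C]_n) : psd A -> psd B -> psd (A + B).
Proof. by move=> pA pB v; rewrite mulmxDr mulmxDl mxE addr_ge0 ?pA ?pB. Qed.

Lemma psdZ n (c : R) (A : 'M[C]_n) : 0 <= c -> psd A -> psd (c%:C *: A).
Proof.
move=> c0 pA v; rewrite -scalemxAr -scalemxAl mxE.
by apply: mulr_ge0; [rewrite ler0c | exact: pA].
Qed.

Lemma psd0 n : psd (0 : 'M[C]_n).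
Proof. by move=> v; rewrite mulmx0 mul0mx mxE. Qed.

Lemma psd_conj m n (W : 'M[C]_(m, n)) (A : 'M[C]_n) : psd A -> psd (W *m A *m adj W).
Proof.
move=> pA v; have := pA (adj W *m v).
by rewrite adjM adjK !mulmxA.
Qed.

Lemma psd_tr n (A : 'M[C]_n) : psd A -> 0 <= \tr A.
Proof. by move=> /psd_sqrt[Y ->]; apply: mxtrace_adj_ge0. Qed.

Lemma psd_tr0 n (A : 'M[C]_n) : psd A -> \tr A = 0 -> A = 0.
Proof. by move=> /psd_sqrt[Y ->] /mxtrace_adj_eq0 ->; rewrite mul0mx. Qed.

Lemma psd_retr0 n (A : 'M[C]_n) : psd A -> Re (\tr A) = 0 -> A = 0.
Proof. by move=> pA t0; apply: psd_tr0 => //; rewrite -(psd_re (psd_tr pA)) t0. Qed.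

(* Not normalised: for X of trace q and von Neumann entropy S (X / q), this is
   q S (X / q) - q ln q. *)
Definition vnent n (X : 'M[C]_n) : R := - Re (\tr (X *m logm X)).
Definition xlnx (x : R) : R := x * ln x.

Lemma vnent_eig n (X U : 'M[C]_n) a : eigdec X U a -> vnent X = - \sum_i xlnx (a 0 i).
Proof.
move=> h; rewrite /vnent (tr_cfun _ _ h); congr (- _); apply: eq_bigr => i _.
by rewrite (eigdec_diag_in i h) mulrC.
Qed.

Lemma ln_le_sub1 (x : R) : 0 < x -> ln x <= x - 1.
Proof. by move=> x0; rewrite {1}(_ : x = 1 + (x - 1)); [apply: le_ln1Dx; lra|ring]. Qed.

(** This is [ln z <= z - 1] at [z = y / x], multiplied by [x]; at [x = 0] it reads [0 <= y]. *)
Lemma klein_scalar (x y : R) : 0 <= x -> 0 < y -> - xlnx x <= y - x - x * ln y.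
Proof.
rewrite le_eqVlt => /predU1P[<- y0|x0 y0]; first by rewrite /xlnx !mul0r; lra.
have h := ln_le_sub1 (divr_gt0 y0 x0).
rewrite ln_div ?posrE // in h; rewrite /xlnx.
have : x * (ln y - ln x) <= x * (y / x - 1) by rewrite ler_pM2l.
by rewrite mulrBr mulrBr mulrCA divff ?gt_eqF // !mulr1; lra.
Qed.

(* The squared overlaps of the two eigenbases form a doubly stochastic matrix,
   which reduces the claim to [klein_scalar]. *)
Lemma klein n (X U : 'M[C]_n) (y : 'I_n -> R) : psd X ->
  adj U *m U = 1%:M -> U *m adj U = 1%:M ->
  (forall i, 0 <= y i) -> (forall i, y i = 0 -> diag_in U X i = 0) ->
  vnent X <= \sum_i (y i - diag_in U X i - diag_in U X i * ln (y i)).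
Proof.
move=> pX u1 u2 y0 yX; have [W [x h]] := herm_eigdec (psd_herm pX).
have x0 i := psd_eigdec i pX h.
have [w1 w2 eX] := h; pose Z := adj U *m W.
have zz : Z *m adj Z = 1%:M by rewrite adjM adjK mulmxA -(mulmxA _ W) w2 mulmx1.
have zz' : adj Z *m Z = 1%:M by exact: mulmx1C.
pose c i k := Re (Z i k * conjC (Z i k)).
have cpos i k : 0 <= c i k by rewrite Re_ge0 // mul_conjC_ge0.
have c1 i : \sum_k c i k = 1.
  have /matrixP/(_ i i) := zz; rewrite !mxE eqxx => /(congr1 Re) /=.
  by rewrite Re_sum => <-; apply: eq_bigr => k _; rewrite adjE.
have c2 k : \sum_i c i k = 1.
  have /matrixP/(_ k k) := zz'; rewrite !mxE eqxx => /(congr1 Re) /=.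
  by rewrite Re_sum => <-; apply: eq_bigr => i _; rewrite adjE /c mulrC.
have dE i : diag_in U X i = \sum_k c i k * x 0 k.
  rewrite /diag_in eX (_ : _ *m U = Z *m rdiag x *m adj Z); last first.
    by rewrite /Z adjM adjK !mulmxA.
  rewrite mxE Re_sum; apply: eq_bigr => k _.
  by rewrite mulmx_rdiagE adjE mulrAC mulrC ReMl mulrC.
rewrite (vnent_eig h) -sumrN.
have -> : \sum_k - xlnx (x 0 k) = \sum_i \sum_k c i k * - xlnx (x 0 k).
  by rewrite exchange_big; apply: eq_bigr => k _; rewrite -mulr_suml c2 mul1r.
have -> : \sum_i (y i - diag_in U X i - diag_in U X i * ln (y i)) =
    \sum_i \sum_k c i k * (y i - x 0 k - x 0 k * ln (y i)).
  apply: eq_bigr => i _; rewrite -[y i in LHS]mul1r -{1}(c1 i) dE !mulr_suml.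
  by rewrite -!sumrB; apply: eq_bigr => k _; rewrite mul1r; ring.
apply: ler_sum => i _; apply: ler_sum => k _.
have [yi|yi] := eqVneq (y i) 0; last first.
  by rewrite ler_wpM2l // klein_scalar // lt_def yi y0.
(* Where [y i = 0] the support hypothesis makes a sum of nonnegative terms [c i k * x_k] vanish, so
   each of them does, and the junk value [ln 0 = 0] is harmless. *)
have /eqP := yX i yi; rewrite dE psumr_eq0 => [/allP /(_ k)|j _]; last by rewrite mulr_ge0.
rewrite mem_index_enum => /(_ isT) /= /eqP e.
by rewrite yi ln0 // mulr0 subr0 sub0r !mulrN e /xlnx mulrA e mul0r.
Qed.

(** Klein's inequality for [X] and for [Y], both in the eigenbasis of the mixture [Z] and with its
    eigenvalues as weights; the weighted right-hand sides add up to [vnent Z]. *)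
Lemma vnent_concave n (X Y : 'M[C]_n) (s t : R) : psd X -> psd Y ->
  0 <= s -> 0 <= t -> s + t = 1 ->
  s * vnent X + t * vnent Y <= vnent (s%:C *: X + t%:C *: Y).
Proof.
move=> pX pY s0 t0 st; set Z := _ *: X + _.
have pZ : psd Z by apply: psdD; apply: psdZ.
have [U [z h]] := herm_eigdec (psd_herm pZ); have [u1 u2 _] := h.
have z0 i := psd_eigdec i pZ h.
have dZ i : s * diag_in U X i + t * diag_in U Y i = z 0 i.
  by rewrite -(eigdec_diag_in i h) diag_inD !diag_inZ.
(* The weight [r = 0] is treated apart: a zero eigenvalue of [Z] then says nothing about [A], and
   [klein] would lack its support condition. *)
have key (r q : R) (A B : 'M[C]_n) : psd A -> psd B -> 0 <= r -> 0 <= q ->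
    (forall i, r * diag_in U A i + q * diag_in U B i = z 0 i) ->
    r * vnent A <= \sum_i (r * z 0 i - r * diag_in U A i - (r * diag_in U A i) * ln (z 0 i)).
  move=> pA pB; rewrite le_eqVlt => /predU1P[<- _ _|r0 q0 dAB].
    by rewrite !mul0r sumr_ge0 // => i _; rewrite !mul0r !subr0.
  rewrite (_ : \sum_i _ = r * \sum_i (z 0 i - diag_in U A i - diag_in U A i * ln (z 0 i))).
    rewrite ler_pM2l //; apply: klein => // i zi; move: (dAB i); rewrite zi => /eqP.
    rewrite paddr_eq0 ?(mulr_ge0 (ltW r0) (diag_in_ge0 _ _ pA)) ?(mulr_ge0 q0 (diag_in_ge0 _ _ pB)) // => /andP[+ _].
    by rewrite mulf_eq0 gt_eqF //= => /eqP.
  by rewrite mulr_sumr; apply: eq_bigr => i _; rewrite !mulrBr mulrA.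
have hX := key s t X Y pX pY s0 t0 dZ.
have hY := key t s Y X pY pX t0 s0 (fun i => etrans (addrC _ _) (dZ i)).
apply: le_trans (lerD hX hY) _; rewrite (vnent_eig h) -big_split -sumrN /=.
apply: ler_sum => i _; rewrite /xlnx.
have e1 : s * z 0 i + t * z 0 i = z 0 i by rewrite -mulrDl st mul1r.
have := dZ i; move: e1; move: (s * z 0 i) (t * z 0 i) (s * diag_in U X i) (t * diag_in U Y i).
by move=> a b u v e1 e2; rewrite -{3}e2 mulrDl; lra.
Qed.

Lemma vnent_adjC m n (K : 'M[C]_(m, n)) : vnent (K *m adj K) = vnent (adj K *m K).
Proof.
rewrite /vnent; congr (- Re _).
have e : logm (K *m adj K) *m K = K *m logm (adj K *m K).
  by apply: cfun_intertwine; rewrite ?adjM ?adjK // mulmxA.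
by rewrite -(mulmxA K) mxtrace_mulC -(mulmxA (adj K) (logm _)) e mulmxA.
Qed.

(** With [X = Y Y^*], passing to the other Gram matrix gives [Y^* W^* W Y], from which [W]
    disappears. *)
Lemma vnent_isom m n (W : 'M[C]_(m, n)) (X : 'M[C]_n) : psd X ->
  adj W *m W = 1%:M -> vnent (W *m X *m adj W) = vnent X.
Proof.
move=> /psd_sqrt[Y ->] w.
have -> : W *m (Y *m adj Y) *m adj W = (W *m Y) *m adj (W *m Y).
  by rewrite adjM !mulmxA.
rewrite [in LHS]vnent_adjC [in RHS]vnent_adjC; congr vnent.
by rewrite adjM mulmxA -(mulmxA _ _ W) w mulmx1.
Qed.

Lemma eta0 n : vnent (0 : 'M[C]_n) = 0.
Proof. by rewrite /vnent mul0mx mxtrace0 oppr0. Qed.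

Lemma eigdecZ n (X U : 'M[C]_n) a (w : R) : eigdec X U a -> eigdec (w%:C *: X) U (w *: a).
Proof.
case=> u1 u2 e; split=> //; rewrite {1}e scalemxAl scalemxAr; congr (_ *m _ *m _).
by apply/matrixP => i j; rewrite !mxE rmorphM mulrnAr.
Qed.

Lemma vnent_scale n (X : 'M[C]_n) (w : R) : psd X -> 0 <= w ->
  vnent (w%:C *: X) = w * vnent X - xlnx w * Re (\tr X).
Proof.
move=> pX; rewrite le_eqVlt => /predU1P[<-|w0].
  by rewrite scale0r eta0 /xlnx !mul0r subr0.
have [U [a h]] := herm_eigdec (psd_herm pX); have [_ u2 _] := h.
rewrite (vnent_eig h) (vnent_eig (eigdecZ w h)) -(diag_in_sum X u2) mulrN mulr_sumr mulr_sumr -opprD.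
rewrite -big_split; congr (- _); apply: eq_bigr => i _ /=.
rewrite mxE (eigdec_diag_in i h) /xlnx.
have := psd_eigdec i pX h; rewrite le_eqVlt => /predU1P[<-|ai]; first by rewrite !(mulr0, mul0r) addr0.
by rewrite lnM ?posrE //; ring.
Qed.

(** The entrywise l1 norm is submultiplicative, multiplicative on tensor products and does not grow
    under partial traces, so all the estimates can be made in it. *)
Definition norm1 m n (A : 'M[C]_(m, n)) : C := \sum_i \sum_j `|A i j|.

Lemma norm1_ge0 m n (A : 'M[C]_(m, n)) : 0 <= norm1 A.
Proof. by apply: sumr_ge0 => i _; apply: sumr_ge0. Qed.

Lemma norm1_adj m n (A : 'M[C]_(m, n)) : norm1 (adj A) = norm1 A.
Proof.
rewrite /norm1 exchange_big; apply: eq_bigr => i _; apply: eq_bigr => j _.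
by rewrite adjE norm_conjC.
Qed.

Lemma norm1D m n (A B : 'M[C]_(m, n)) : norm1 (A + B) <= norm1 A + norm1 B.
Proof.
rewrite -big_split; apply: ler_sum => i _; rewrite -big_split; apply: ler_sum => j _.
by rewrite mxE ler_normD.
Qed.

Lemma norm1N m n (A : 'M[C]_(m, n)) : norm1 (- A) = norm1 A.
Proof. by apply: eq_bigr => i _; apply: eq_bigr => j _; rewrite mxE normrN. Qed.

Lemma entry_norm1 m n (A : 'M[C]_(m, n)) i j : `|A i j| <= norm1 A.
Proof.
rewrite /norm1 (bigD1 i) //= (bigD1 j) //= -addrA lerDl addr_ge0 ?sumr_ge0 // => k _.
by apply: sumr_ge0.
Qed.

Lemma norm1M m n p (A : 'M[C]_(m, n)) (B : 'M[C]_(n, p)) : norm1 (A *m B) <= norm1 A * norm1 B.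
Proof.
rewrite /norm1 mulr_suml; apply: ler_sum => i _; rewrite mulr_suml.
apply: (@le_trans _ _ (\sum_j \sum_k `|A i k| * `|B k j|)).
  apply: ler_sum => j _; rewrite mxE (le_trans (ler_norm_sum _ _ _)) //.
  by apply: ler_sum => k _; rewrite normrM.
rewrite exchange_big; apply: ler_sum => k _; rewrite -mulr_sumr ler_wpM2l //.
by rewrite (bigD1 k) //= lerDl; apply: sumr_ge0 => l _; apply: sumr_ge0.
Qed.

Lemma norm1_tens m n p q (A : 'M[C]_(m, n)) (B : 'M[C]_(p, q)) :
  norm1 (A *t B) = norm1 A * norm1 B.
Proof.
rewrite /norm1 mulr_sum; apply: eq_bigr => i _; rewrite mulr_sum; apply: eq_bigr => j _.
by rewrite mxE normrM.
Qed.

Lemma unitary_entry m n (U : 'M[C]_(m, n)) i j : adj U *m U = 1%:M -> `|U i j| <= 1.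
Proof.
move=> /matrixP/(_ j j); rewrite !mxE eqxx /= => e.
rewrite -(@ler_pXn2r _ 2) ?nnegrE // expr1n normCKC -[leRHS]e (bigD1 i) //= adjE lerDl.
by apply: sumr_ge0 => k _; rewrite adjE mulrC mul_conjC_ge0.
Qed.

Lemma diag_in_norm1 n (U X : 'M[C]_n) i : adj U *m U = 1%:M -> `|diag_in U X i|%:C <= norm1 X.
Proof.
move=> u; apply: le_trans (normc_ge_Re _) _; rewrite mxE.
apply: le_trans (ler_norm_sum _ _ _) _; rewrite /norm1 exchange_big.
apply: ler_sum => l _; rewrite normrM; apply: (@le_trans _ _ `|(adj U *m X) i l|).
  by rewrite -[leRHS]mulr1 ler_wpM2l // unitary_entry.
rewrite mxE; apply: le_trans (ler_norm_sum _ _ _) _; apply: ler_sum => k _.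
by rewrite normrM adjE norm_conjC -[leRHS]mul1r ler_wpM2r // unitary_entry.
Qed.

(* Klein's inequality for Y in the eigenbasis of X, with the weights x_i + s. *)
Lemma vnent_modulus n (e : R) : 0 < e -> exists d : R, 0 < d /\
  forall X Y : 'M[C]_n, psd X -> psd Y -> Re (\tr X) <= 1 ->
  norm1 (Y - X) <= d%:C -> vnent Y <= vnent X + e.
Proof.
(* Each of the [n] terms of Klein's bound will exceed its target by at most [2 s]; [n.+1] keeps the
   divisor positive when [n = 0]. *)
move=> e0; pose s := e / (2 * n.+1%:R); have n0 : 0 < n.+1%:R :> R by rewrite ltr0n.
have s0 : 0 < s by rewrite divr_gt0 // mulr_gt0.
(* As [x_i] lies in [0, 1], [ln (x_i + s)] lies between [ln s] and [ln (1 + s)], so [L] bounds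
   [1 + ln (x_i + s)], the factor that multiplies the perturbation. *)
pose L := 1 + (`|ln s| + `|ln (1 + s)|).
have L0 : 0 < L by rewrite /L ltr_pwDl // addr_ge0.
exists (s / L); split; first by rewrite divr_gt0.
move=> X Y pX pY X1 XY.
have [U [x h]] := herm_eigdec (psd_herm pX); have [u1 u2 _] := h.
have x0 i := psd_eigdec i pX h.
have x1 i : x 0 i <= 1.
  apply: le_trans X1; rewrite -(diag_in_sum X u2) (bigD1 i) //= (eigdec_diag_in i h) lerDl.
  by apply: sumr_ge0 => j _; apply: diag_in_ge0.
have xs i : 0 < x 0 i + s by rewrite ltr_wpDl.
have hK := @klein n Y U (fun i => x 0 i + s) pY u1 u2 (fun i => ltW (xs i)).
apply: le_trans (hK _) _ => [i /eqP|]; first by rewrite gt_eqF.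
have term i : x 0 i + s - diag_in U Y i - diag_in U Y i * ln (x 0 i + s) <= - xlnx (x 0 i) + 2 * s.
  have dd : diag_in U Y i = x 0 i + diag_in U (Y - X) i.
    by rewrite -(eigdec_diag_in i h) -diag_inD addrC subrK.
  have hd : `|diag_in U (Y - X) i| <= s / L by rewrite -lecR (le_trans (diag_in_norm1 _ _ u1)).
  have hl : `|1 + ln (x 0 i + s)| <= L.
    apply: le_trans (ler_normD _ _) _; rewrite normr1 lerD2l.
    have [l0|l0] := leP 0 (ln (x 0 i + s)).
      apply: (@le_trans _ _ `|ln (1 + s)|); last by rewrite lerDr.
      rewrite ger0_norm //; apply: le_trans (ler_norm _).
      by rewrite ler_ln ?posrE ?xs ?addr_gt0 //; have := x1 i; lra.
    apply: (@le_trans _ _ `|ln s|); last by rewrite lerDl.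
    rewrite ltr0_norm //; apply: (@le_trans _ _ (- ln s)); last by rewrite -normrN ler_norm.
    by rewrite lerN2 ler_ln ?posrE ?xs //; have := x0 i; lra.
  have hm : `|diag_in U (Y - X) i * (1 + ln (x 0 i + s))| <= s.
    rewrite normrM; apply: le_trans (ler_pM _ _ hd hl) _ => //.
    by rewrite divfK ?gt_eqF.
  have hx : xlnx (x 0 i) <= x 0 i * ln (x 0 i + s).
    have := x0 i; rewrite le_eqVlt => /predU1P[<-|xi]; first by rewrite /xlnx !mul0r.
    by rewrite ler_wpM2l ?x0 // ler_ln ?posrE ?xs //; lra.
  have := ler_norm (- (diag_in U (Y - X) i * (1 + ln (x 0 i + s)))); rewrite normrN.
  by rewrite dd; lra.
apply: le_trans (ler_sum _ (fun i _ => term i)) _.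
rewrite big_split /= (vnent_eig h) sumrN lerD2l sumr_const card_ord -[_ *+ n]mulr_natl.
apply: (@le_trans _ _ (n.+1%:R * (2 * s))).
  by rewrite ler_pM2r ?mulr_gt0 // ler_nat.
have E (N : R) : 0 < N -> N * (2 * (e / (2 * N))) = e by move=> N0; field; rewrite gt_eqF.
by rewrite E.
Qed.

End Entropy.

(** * Partial traces and the cost of a block *)

Section PartialTrace.
Variable R : realType.
Local Notation C := R[i].
Local Notation Re := (@complex.Re R).

Lemma sum_tens (V : nmodType) m n (F : 'I_(m * n) -> V) :
  \sum_x F x = \sum_i \sum_k F (mxtens_index (i, k)).
Proof.
rewrite pair_big; apply: etrans (reindex _ _) _; last by apply: eq_bigr => -[].
by exists (@mxtens_unindex m n) => x _; rewrite (mxtens_indexK, mxtens_unindexK).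
Qed.

Definition ptr_snd m n (S : 'M[C]_(m * n)) : 'M[C]_m :=
  \matrix_(i, j) \sum_k S (mxtens_index (i, k)) (mxtens_index (j, k)).
Definition ptr_fst m n (S : 'M[C]_(m * n)) : 'M[C]_n :=
  \matrix_(i, j) \sum_k S (mxtens_index (k, i)) (mxtens_index (k, j)).

(** The duality that characterises the partial trace. With [mxtrace_ext] it replaces index sums by
    cyclicity of the trace in the identities below. *)
Lemma mxtrace_ptr_snd m n (Z : 'M[C]_m) (S : 'M[C]_(m * n)) :
  \tr ((Z *t 1%:M) *m S) = \tr (Z *m ptr_snd S).
Proof.
rewrite /mxtrace sum_tens; apply: eq_bigr => i _.
rewrite [RHS]mxE; under eq_bigr do rewrite mxE sum_tens.
rewrite exchange_big; apply: eq_bigr => j _; rewrite mxE mulr_sumr.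
apply: eq_bigr => k _; rewrite (bigD1 k) //= tensmxE mxE eqxx mulr1 big1 ?addr0 // => l kl.
by rewrite tensmxE mxE eq_sym (negPf kl) mulr0 mul0r.
Qed.

Lemma mxtrace_ptr_fst m n (Z : 'M[C]_n) (S : 'M[C]_(m * n)) :
  \tr ((1%:M *t Z) *m S) = \tr (Z *m ptr_fst S).
Proof.
rewrite /mxtrace sum_tens exchange_big; apply: eq_bigr => i _.
rewrite [RHS]mxE; under eq_bigr do rewrite mxE sum_tens exchange_big.
rewrite exchange_big; apply: eq_bigr => j _; rewrite mxE mulr_sumr.
apply: eq_bigr => k _; rewrite (bigD1 k) //= tensmxE mxE eqxx mul1r big1 ?addr0 // => l kl.
by rewrite tensmxE mxE eq_sym (negPf kl) !mul0r.
Qed.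

Lemma mxtrace_ext n (X Y : 'M[C]_n) :
  (forall Z, \tr (Z *m X) = \tr (Z *m Y)) -> X = Y.
Proof.
move=> h; have e (X' : 'M[C]_n) i j : \tr (delta_mx j i *m X') = X' i j.
  rewrite /mxtrace (bigD1 j) //= big1 ?addr0 => [|k kj].
    rewrite mxE (bigD1 i) //= big1 ?addr0 => [|l li]; first by rewrite mxE !eqxx mul1r.
    by rewrite mxE (negPf li) andbF mul0r.
  by rewrite mxE big1 // => l _; rewrite mxE (negPf kj) mul0r.
by apply/matrixP => i j; rewrite -!e h.
Qed.

Lemma mxtrace_ptr_sndE m n (S : 'M[C]_(m * n)) : \tr (ptr_snd S) = \tr S.
Proof. by rewrite -[ptr_snd S]mul1mx -mxtrace_ptr_snd tens11 mul1mx. Qed.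
Lemma mxtrace_ptr_fstE m n (S : 'M[C]_(m * n)) : \tr (ptr_fst S) = \tr S.
Proof. by rewrite -[ptr_fst S]mul1mx -mxtrace_ptr_fst tens11 mul1mx. Qed.

Lemma ptr_sndD m n (S S' : 'M[C]_(m * n)) : ptr_snd (S + S') = ptr_snd S + ptr_snd S'.
Proof.
by apply/matrixP => i j; rewrite !mxE -big_split; apply: eq_bigr => k _; rewrite mxE.
Qed.
Lemma ptr_sndZ m n c (S : 'M[C]_(m * n)) : ptr_snd (c *: S) = c *: ptr_snd S.
Proof.
by apply/matrixP => i j; rewrite !mxE mulr_sumr; apply: eq_bigr => k _; rewrite mxE.
Qed.
Lemma ptr_fstD m n (S S' : 'M[C]_(m * n)) : ptr_fst (S + S') = ptr_fst S + ptr_fst S'.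
Proof.
by apply/matrixP => i j; rewrite !mxE -big_split; apply: eq_bigr => k _; rewrite mxE.
Qed.
Lemma ptr_fstZ m n c (S : 'M[C]_(m * n)) : ptr_fst (c *: S) = c *: ptr_fst S.
Proof.
by apply/matrixP => i j; rewrite !mxE mulr_sumr; apply: eq_bigr => k _; rewrite mxE.
Qed.

Lemma norm1_ptr_snd m n (S : 'M[C]_(m * n)) : norm1 (ptr_snd S) <= norm1 S.
Proof.
rewrite /norm1 sum_tens; apply: ler_sum => i _.
apply: (@le_trans _ _ (\sum_j \sum_k `|S (mxtens_index (i, k)) (mxtens_index (j, k))|)).
  by apply: ler_sum => j _; rewrite mxE ler_norm_sum.
rewrite exchange_big; apply: ler_sum => k _; rewrite sum_tens; apply: ler_sum => j _.
by rewrite (bigD1 k) //= lerDl; apply: sumr_ge0.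
Qed.

Lemma norm1_ptr_fst m n (S : 'M[C]_(m * n)) : norm1 (ptr_fst S) <= norm1 S.
Proof.
rewrite [leRHS]/norm1 sum_tens [leRHS]exchange_big; apply: ler_sum => i _.
apply: (@le_trans _ _ (\sum_j \sum_k `|S (mxtens_index (k, i)) (mxtens_index (k, j))|)).
  by apply: ler_sum => j _; rewrite mxE ler_norm_sum.
rewrite exchange_big; apply: ler_sum => k _; rewrite sum_tens exchange_big.
apply: ler_sum => j _.
by rewrite (bigD1 k) //= lerDl; apply: sumr_ge0.
Qed.

(** Cyclicity on the factor that is traced out merges the two copies of [Q] into [Q^* Q]: this
    marginal depends linearly on [Q^* Q]. *)
Lemma ptr_snd_conj m n m' n' (P : 'M[C]_(m', m)) (Q : 'M[C]_(n', n)) (S : 'M[C]_(m * n)) :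
  ptr_snd ((P *t Q) *m S *m adj (P *t Q)) =
  P *m ptr_snd ((1%:M *t (adj Q *m Q)) *m S) *m adj P.
Proof.
apply: mxtrace_ext => Z; rewrite -mxtrace_ptr_snd !mulmxA mxtrace_mulC !mulmxA.
rewrite adj_tens !tensmx_mul mulmx1 [RHS]mxtrace_mulC !mulmxA -mxtrace_ptr_snd !mulmxA.
by rewrite !tensmx_mul mulmx1 mul1mx.
Qed.

Lemma ptr_fst_conj m n m' n' (P : 'M[C]_(m', m)) (Q : 'M[C]_(n', n)) (S : 'M[C]_(m * n)) :
  ptr_fst ((P *t Q) *m S *m adj (P *t Q)) =
  Q *m ptr_fst (((adj P *m P) *t 1%:M) *m S) *m adj Q.
Proof.
apply: mxtrace_ext => Z; rewrite -mxtrace_ptr_fst !mulmxA mxtrace_mulC !mulmxA.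
rewrite adj_tens !tensmx_mul mulmx1 [RHS]mxtrace_mulC !mulmxA -mxtrace_ptr_fst !mulmxA.
by rewrite !tensmx_mul mulmx1 mul1mx.
Qed.

Lemma psd_ptr_snd m n (S : 'M[C]_(m * n)) : psd S -> psd (ptr_snd S).
Proof.
move=> /psd_sqrt[Y ->] v; rewrite -trace_mx11 -mulmxA mxtrace_mulC -mulmxA.
(* The form of the marginal at [v] is the trace of [S] conjugated by [adj v *t 1%:M]. *)
rewrite mxtrace_mulC -mxtrace_ptr_snd -[1%:M]mulmx1 -tensmx_mul -mulmxA mxtrace_mulC.
have -> : v *t 1%:M = adj (adj v *t 1%:M) :> 'M[C]_(m * n, 1 * n).
  by rewrite adj_tens adjK adj1.
exact: psd_tr (psd_conj _ (psd_adj Y)).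
Qed.

Lemma psd_ptr_fst m n (S : 'M[C]_(m * n)) : psd S -> psd (ptr_fst S).
Proof.
move=> /psd_sqrt[Y ->] v; rewrite -trace_mx11 -mulmxA mxtrace_mulC -mulmxA.
rewrite mxtrace_mulC -mxtrace_ptr_fst -[1%:M]mulmx1 -tensmx_mul -mulmxA mxtrace_mulC.
have -> : 1%:M *t v = adj (1%:M *t adj v) :> 'M[C]_(m * n, m * 1).
  by rewrite adj_tens adjK adj1.
exact: psd_tr (psd_conj _ (psd_adj Y)).
Qed.

Lemma castmx_mul3 m m' n n' p p' (e1 : m = m') (e2 : n = n') (e3 : p = p')
  (A : 'M[C]_(m, n)) (B : 'M[C]_(n, p)) :
  castmx (e1, e3) (A *m B) = castmx (e1, e2) A *m castmx (e2, e3) B.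
Proof. by case: m' / e1; case: n' / e2; case: p' / e3. Qed.

Lemma tens_assoc4 a b c d a' b' c' d' (A : 'M[C]_(a, a')) (B : 'M[C]_(b, b'))
    (E : 'M[C]_(c, c')) (F : 'M[C]_(d, d')) :
  castmx (tens_assoc_eq a b c d, tens_assoc_eq a' b' c' d') ((A *t B) *t (E *t F)) =
  (A *t (B *t E)) *t F.
Proof.
have idx p q r s (x : 'I_p) (y : 'I_q) (z : 'I_r) (w : 'I_s) :
    cast_ord (esym (tens_assoc_eq p q r s))
      (mxtens_index (mxtens_index (x, mxtens_index (y, z)), w)) =
    mxtens_index (mxtens_index (x, y), mxtens_index (z, w)).
  by apply: val_inj => /=; rewrite !mulnDl !mulnA !addnA.
apply/matrixP => i j; rewrite castmxE.
case: (mxtens_indexP i) => i0 w; case: (mxtens_indexP i0) => x i1; case: (mxtens_indexP i1) => y z.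
case: (mxtens_indexP j) => j0 w'; case: (mxtens_indexP j0) => x' j1; case: (mxtens_indexP j1) => y' z'.
by rewrite /= !idx !tensmxE !mulrA.
Qed.

Lemma convex_combine (s t a0 a1 b0 b1 x A B : R) : s + t = 1 ->
  s * a0 + t * a1 <= A -> s * b0 + t * b1 <= B ->
  s * (a0 + b0 + x) + t * (a1 + b1 + x) <= A + B + x.
Proof.
move=> st hA hB; have ex : s * x + t * x = x by rewrite -mulrDl st mul1r.
by rewrite -[x in leRHS]ex !mulrDr addrACA lerD // addrACA lerD.
Qed.

Section Ampl.
Variables (dA b dC : nat).

(* P (x) M (x) Q with the output regrouped as (A' L) (R C'), the cut along which
   the blocks of a Markov state factorise. *)
Definition ampl3 dA' dC' l r (P : 'M[C]_(dA', dA)) (M : 'M[C]_(l * r, b)) (Q : 'M[C]_(dC', dC))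
  : 'M[C]_(dA' * l * (r * dC'), dA * b * dC) :=
  castmx (esym (tens_assoc_eq dA' l r dC'), erefl) ((P *t M) *t Q).

Lemma ampl3_gram dA' dC' l r (P : 'M[C]_(dA', dA)) (M : 'M[C]_(l * r, b)) (Q : 'M[C]_(dC', dC)) :
  adj (ampl3 P M Q) *m ampl3 P M Q = ((adj P *m P) *t (adj M *m M)) *t (adj Q *m Q).
Proof.
have cc m m' n (e : m = m') (A : 'M[C]_(m, n)) :
    adj (castmx (e, erefl) A) *m castmx (e, erefl) A = adj A *m A.
  by case: m' / e.
by rewrite cc !adj_tens !tensmx_mul.
Qed.

Definition ampl l r (M : 'M[C]_(l * r, b)) := ampl3 (1%:M : 'M_dA) M (1%:M : 'M_dC).

(** [K] and [L] end up on different sides of the cut, so each of them acts locally on one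
    marginal. *)
Lemma ampl3_mul dA' dC' l r l' r' (P : 'M[C]_(dA', dA)) (Q : 'M[C]_(dC', dC))
    (K : 'M[C]_(l', l)) (L : 'M[C]_(r', r)) (M : 'M[C]_(l * r, b)) :
  ampl3 P ((K *t L) *m M) Q = ((P *t K) *t (L *t Q)) *m ampl M.
Proof.
rewrite /ampl /ampl3 -{1}[P]mulmx1 -{1}[Q]mulmx1 -!tensmx_mul.
rewrite (castmx_mul3 _ (esym (tens_assoc_eq dA l r dC))); congr (_ *m _).
rewrite -tens_assoc4 castmx_comp castmx_id //.
Qed.

Variable rho : 'M[C]_(dA * b * dC).

Definition sig l r (M : 'M[C]_(l * r, b)) := ampl M *m rho *m adj (ampl M).

(* Minimal value of - tr (S log (p mu_L (x) mu_R)) + p - q over p >= 0 and states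
   mu_L, mu_R, where S is the block cut out by the Kraus operator M and q = tr S. *)
Definition cost l r (M : 'M[C]_(l * r, b)) : R :=
  vnent (ptr_snd (sig M)) + vnent (ptr_fst (sig M)) + xlnx (Re (\tr (sig M))).

Lemma mxtrace_sig l r (M : 'M[C]_(l * r, b)) :
  \tr (sig M) = \tr (((1%:M *t (adj M *m M)) *t 1%:M) *m rho).
Proof. by rewrite mxtrace_mulC mulmxA ampl3_gram !adj1 !mulmx1. Qed.

Lemma sig_mul l r l' r' (K : 'M[C]_(l', l)) (L : 'M[C]_(r', r)) (M : 'M[C]_(l * r, b)) :
  sig ((K *t L) *m M) =
  ((1%:M *t K) *t (L *t 1%:M)) *m sig M *m adj ((1%:M *t K) *t (L *t 1%:M)).
Proof. by rewrite /sig {1 2}/ampl !ampl3_mul adjM !mulmxA. Qed.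

Hypothesis prho : psd rho.

Lemma psd_sig l r (M : 'M[C]_(l * r, b)) : psd (sig M).
Proof. exact: psd_conj. Qed.

Section Right.
Variables (l r : nat) (M : 'M[C]_(l * r, b)).
Let T2 (T : 'M[C]_r) := ptr_snd ((1%:M *t (T *t 1%:M)) *m sig M).

Lemma sig_right2 r' (L : 'M[C]_(r', r)) :
  ptr_snd (sig ((1%:M *t L) *m M)) = T2 (adj L *m L).
Proof.
rewrite sig_mul ptr_snd_conj adj_tens tensmx_mul adj1 tens11 mulmx1 mul1mx.
by rewrite adj1 mulmx1.
Qed.

(* K K^* and K^* K have the same entropy: this makes the entropy of the second
   marginal depend on L only through L^* L, inside an affine argument. *)
Lemma sig_right1 r' (L : 'M[C]_(r', r)) (Y : 'M[C]_(r * dC)) : ptr_fst (sig M) = Y *m adj Y ->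
  vnent (ptr_fst (sig ((1%:M *t L) *m M))) = vnent (adj Y *m ((adj L *m L) *t 1%:M) *m Y).
Proof.
move=> e; rewrite sig_mul ptr_fst_conj tens11 adj1 mulmx1 tens11 mul1mx e.
rewrite (_ : _ *m _ *m _ = ((L *t 1%:M) *m Y) *m adj ((L *t 1%:M) *m Y)).
  by rewrite vnent_adjC adjM !mulmxA -(mulmxA _ (adj (_ *t _))) adj_tens tensmx_mul adj1 mulmx1.
by rewrite adjM !mulmxA.
Qed.

(** Keeps the term [xlnx (Re (\tr (sig M)))] constant while a block is shrunk; being convex, it
    would otherwise spoil concavity. *)
Lemma mxtrace_sig_gram l' r' (M' : 'M[C]_(l' * r', b)) :
  adj M' *m M' = adj M *m M -> \tr (sig M') = \tr (sig M).
Proof. by move=> e; rewrite !mxtrace_sig e. Qed.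

Lemma cost_rightE r' (L : 'M[C]_(r', r)) (Y : 'M[C]_(r * dC)) :
  ptr_fst (sig M) = Y *m adj Y ->
  adj ((1%:M *t L) *m M) *m ((1%:M *t L) *m M) = adj M *m M ->
  cost ((1%:M *t L) *m M) = vnent (T2 (adj L *m L)) +
    vnent (adj Y *m ((adj L *m L) *t 1%:M) *m Y) + xlnx (Re (\tr (sig M))).
Proof.
move=> eY e; rewrite /cost (sig_right1 L eY) sig_right2.
by rewrite (mxtrace_sig_gram e).
Qed.

(** Used to pad the right factor up to dimension [b]. *)
Lemma cost_right_isom r' (L : 'M[C]_(r', r)) : adj L *m L = 1%:M ->
  cost ((1%:M *t L) *m M) = cost M.
Proof.
move=> e; have [Y eY] := psd_sqrt (psd_ptr_fst (psd_sig M)).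
rewrite /cost (sig_right1 L eY) sig_right2 e tens11 mulmx1 -vnent_adjC -eY.
rewrite mxtrace_sig_gram; last by rewrite adjM mulmxA -(mulmxA _ (adj _)) adj_tens tensmx_mul e adj1 mulmx1 tens11 mulmx1.
by rewrite /T2 tens11 tens11 mul1mx.
Qed.

Lemma cost_right_concave r0 r1 (L0 : 'M[C]_(r0, r)) (L1 : 'M[C]_(r1, r)) (s t : R) :
  0 <= s -> 0 <= t -> s + t = 1 ->
  s%:C *: (adj L0 *m L0) + t%:C *: (adj L1 *m L1) = 1%:M ->
  adj ((1%:M *t L0) *m M) *m ((1%:M *t L0) *m M) = adj M *m M ->
  adj ((1%:M *t L1) *m M) *m ((1%:M *t L1) *m M) = adj M *m M ->
  s * cost ((1%:M *t L0) *m M) + t * cost ((1%:M *t L1) *m M) <= cost M.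
Proof.
move=> s0 t0 st eT e0 e1; have [Y eY] := psd_sqrt (psd_ptr_fst (psd_sig M)).
rewrite (cost_rightE eY e0) (cost_rightE eY e1) /cost.
have ha : s * vnent (T2 (adj L0 *m L0)) + t * vnent (T2 (adj L1 *m L1)) <= vnent (ptr_snd (sig M)).
  have lin (A B : 'M[C]_r) : 1%:M *t ((s%:C *: A + t%:C *: B) *t 1%:M) =
      s%:C *: (1%:M *t (A *t 1%:M)) + t%:C *: (1%:M *t (B *t 1%:M))
      :> 'M[C]_(dA * l * (r * dC)).
    by rewrite tensDl !tensZl tensDr !tensZr.
  have -> : ptr_snd (sig M) = s%:C *: T2 (adj L0 *m L0) + t%:C *: T2 (adj L1 *m L1).
    rewrite /T2 -!ptr_sndZ -ptr_sndD [_ *: (_ *m _)]scalemxAl [t%:C *: (_ *m _)]scalemxAl -mulmxDl -lin eT.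
    by rewrite !tens11 mul1mx.
  by apply: vnent_concave; rewrite -?sig_right2 //; apply/psd_ptr_snd/psd_sig.
have hb : s * vnent (adj Y *m ((adj L0 *m L0) *t 1%:M) *m Y) +
    t * vnent (adj Y *m ((adj L1 *m L1) *t 1%:M) *m Y) <= vnent (ptr_fst (sig M)).
  (* At [L^* L = 1] the affine expression is [Y^* Y], which has the entropy of [Y Y^*], the marginal
     itself. *)
  have -> : vnent (ptr_fst (sig M)) = vnent (s%:C *: (adj Y *m ((adj L0 *m L0) *t 1%:M) *m Y)
      + t%:C *: (adj Y *m ((adj L1 *m L1) *t 1%:M) *m Y)).
    have lin (A B : 'M[C]_r) : adj Y *m ((s%:C *: A + t%:C *: B) *t 1%:M) *m Y =
        s%:C *: (adj Y *m (A *t 1%:M) *m Y) + t%:C *: (adj Y *m (B *t 1%:M) *m Y).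
      by rewrite tensDl !tensZl mulmxDr mulmxDl -!scalemxAr -!scalemxAl.
    by rewrite -lin eT tens11 mulmx1 eY vnent_adjC.
  have pp r' (L : 'M[C]_(r', r)) : psd (adj Y *m ((adj L *m L) *t 1%:M) *m Y).
    have -> : adj Y *m ((adj L *m L) *t 1%:M) *m Y =
        (adj Y *m (adj L *t (1%:M : 'M[C]_dC))) *m adj (adj Y *m (adj L *t 1%:M)).
      by rewrite adjM adjK adj_tens adjK adj1 !mulmxA -(mulmxA _ (adj _ *t _)) tensmx_mul mulmx1.
    exact: psd_adj.
  exact: vnent_concave.
exact: convex_combine ha hb.
Qed.
End Right.

Section Left.
Variables (l r : nat) (M : 'M[C]_(l * r, b)).
Let T1 (T : 'M[C]_l) := ptr_fst (((1%:M *t T) *t 1%:M) *m sig M).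

Lemma sig_left1 l' (K : 'M[C]_(l', l)) :
  ptr_fst (sig ((K *t 1%:M) *m M)) = T1 (adj K *m K).
Proof.
rewrite sig_mul ptr_fst_conj adj_tens tensmx_mul adj1 tens11 mulmx1 mul1mx.
by rewrite adj1 mulmx1.
Qed.

Lemma sig_left2 l' (K : 'M[C]_(l', l)) (Y : 'M[C]_(dA * l)) :
  ptr_snd (sig M) = Y *m adj Y ->
  vnent (ptr_snd (sig ((K *t 1%:M) *m M))) = vnent (adj Y *m (1%:M *t (adj K *m K)) *m Y).
Proof.
move=> e; rewrite sig_mul ptr_snd_conj tens11 adj1 mulmx1 tens11 mul1mx e.
rewrite (_ : _ *m _ *m _ = ((1%:M *t K) *m Y) *m adj ((1%:M *t K) *m Y)).
  by rewrite vnent_adjC adjM !mulmxA -(mulmxA _ (adj (_ *t _))) adj_tens tensmx_mul adj1 mulmx1.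
by rewrite adjM !mulmxA.
Qed.

Lemma cost_leftE l' (K : 'M[C]_(l', l)) (Y : 'M[C]_(dA * l)) :
  ptr_snd (sig M) = Y *m adj Y ->
  adj ((K *t 1%:M) *m M) *m ((K *t 1%:M) *m M) = adj M *m M ->
  cost ((K *t 1%:M) *m M) = vnent (T1 (adj K *m K)) +
    vnent (adj Y *m (1%:M *t (adj K *m K)) *m Y) + xlnx (Re (\tr (sig M))).
Proof.
move=> eY e; rewrite /cost (sig_left2 K eY) sig_left1.
by rewrite (mxtrace_sig_gram e) [X in X + _ = _]addrC.
Qed.

Lemma cost_left_isom l' (K : 'M[C]_(l', l)) : adj K *m K = 1%:M ->
  cost ((K *t 1%:M) *m M) = cost M.
Proof.
move=> e; have [Y eY] := psd_sqrt (psd_ptr_snd (psd_sig M)).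
rewrite /cost (sig_left2 K eY) sig_left1 e tens11 mulmx1 -vnent_adjC -eY.
rewrite (@mxtrace_sig_gram _ _ M); last by rewrite adjM mulmxA -(mulmxA _ (adj _)) adj_tens tensmx_mul e adj1 mulmx1 tens11 mulmx1.
by rewrite /T1 tens11 tens11 mul1mx.
Qed.

(** The mirror image of [cost_right_concave]: now the first factor is acted on, so the second
    marginal is the affine one and the first goes through [Y]. *)
Lemma cost_left_concave l0 l1 (K0 : 'M[C]_(l0, l)) (K1 : 'M[C]_(l1, l)) (s t : R) :
  0 <= s -> 0 <= t -> s + t = 1 ->
  s%:C *: (adj K0 *m K0) + t%:C *: (adj K1 *m K1) = 1%:M ->
  adj ((K0 *t 1%:M) *m M) *m ((K0 *t 1%:M) *m M) = adj M *m M ->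
  adj ((K1 *t 1%:M) *m M) *m ((K1 *t 1%:M) *m M) = adj M *m M ->
  s * cost ((K0 *t 1%:M) *m M) + t * cost ((K1 *t 1%:M) *m M) <= cost M.
Proof.
move=> s0 t0 st eT e0 e1; have [Y eY] := psd_sqrt (psd_ptr_snd (psd_sig M)).
rewrite (cost_leftE eY e0) (cost_leftE eY e1) /cost [X in _ <= X + _]addrC.
have ha : s * vnent (T1 (adj K0 *m K0)) + t * vnent (T1 (adj K1 *m K1)) <= vnent (ptr_fst (sig M)).
  have lin (A B : 'M[C]_l) : (1%:M *t (s%:C *: A + t%:C *: B)) *t 1%:M =
      s%:C *: ((1%:M *t A) *t 1%:M) + t%:C *: ((1%:M *t B) *t 1%:M)
      :> 'M[C]_(dA * l * (r * dC)).
    by rewrite tensDr !tensZr tensDl !tensZl.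
  have -> : ptr_fst (sig M) = s%:C *: T1 (adj K0 *m K0) + t%:C *: T1 (adj K1 *m K1).
    rewrite /T1 -!ptr_fstZ -ptr_fstD [_ *: (_ *m _)]scalemxAl [t%:C *: (_ *m _)]scalemxAl -mulmxDl -lin eT.
    by rewrite !tens11 mul1mx.
  by apply: vnent_concave; rewrite -?sig_left1 //; apply/psd_ptr_fst/psd_sig.
have hb : s * vnent (adj Y *m (1%:M *t (adj K0 *m K0)) *m Y) +
    t * vnent (adj Y *m (1%:M *t (adj K1 *m K1)) *m Y) <= vnent (ptr_snd (sig M)).
  have -> : vnent (ptr_snd (sig M)) = vnent (s%:C *: (adj Y *m (1%:M *t (adj K0 *m K0)) *m Y)
      + t%:C *: (adj Y *m (1%:M *t (adj K1 *m K1)) *m Y)).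
    have lin (A B : 'M[C]_l) : adj Y *m (1%:M *t (s%:C *: A + t%:C *: B)) *m Y =
        s%:C *: (adj Y *m (1%:M *t A) *m Y) + t%:C *: (adj Y *m (1%:M *t B) *m Y).
      by rewrite tensDr !tensZr mulmxDr mulmxDl -!scalemxAr -!scalemxAl.
    by rewrite -lin eT tens11 mulmx1 eY vnent_adjC.
  have pp l' (K : 'M[C]_(l', l)) : psd (adj Y *m (1%:M *t (adj K *m K)) *m Y).
    have -> : adj Y *m (1%:M *t (adj K *m K)) *m Y =
        (adj Y *m ((1%:M : 'M[C]_dA) *t adj K)) *m adj (adj Y *m (1%:M *t adj K)).
      by rewrite adjM adjK adj_tens adjK adj1 !mulmxA -(mulmxA _ (_ *t adj _)) tensmx_mul mulmx1.
    exact: psd_adj.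
  exact: vnent_concave.
exact: convex_combine ha hb.
Qed.
End Left.

End Ampl.
End PartialTrace.

(** * Bounding the dimensions and the number of blocks *)

Section Reduction.
Variable R : realType.
Local Notation C := R[i].
Local Notation Re := (@complex.Re R).

Lemma lin_dep k n (v : 'I_k -> 'rV[C]_n) : (n < k)%N ->
  exists c : 'I_k -> C, (exists j, c j != 0) /\ \sum_j c j *: v j = 0.
Proof.
move=> nk; pose G : 'M[C]_(k, n) := \matrix_(j, i) v j 0 i.
have : kermx G != 0.
  by rewrite -mxrank_eq0 mxrank_ker subn_eq0 -ltnNge (leq_ltn_trans (rank_leq_col _)).
case/rowV0Pn => u /sub_kermxP uG u0; exists (u 0); split.
  apply: contrapT => /forallNP h; case/eqP: u0; apply/rowP => j; rewrite mxE.
  by have := h j => /negP; rewrite negbK => /eqP.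
apply/rowP => i; move/matrixP/(_ 0 i): uG; rewrite !mxE summxE; apply: etrans.
by apply: eq_bigr => j _; rewrite !mxE.
Qed.

(* Requiring X to be traceless forces eigenvalues of both signs, so that the
   segment of positive matrices 1 + t X is bounded on both sides. *)
Lemma herm_dep r b (Phi : 'M[C]_r -> 'M[C]_b) :
  (forall X Y, Phi (X + Y) = Phi X + Phi Y) -> (forall c X, Phi (c *: X) = c *: Phi X) ->
  (forall X, Phi (adj X) = adj (Phi X)) -> (0 < b < r)%N ->
  exists X : 'M[C]_r, [/\ adj X = X, X != 0, \tr X = 0 & Phi X = 0].
Proof.
move=> PhiD PhiZ PhiA /andP[b0 br].
(* There are [b * b] equations for [Phi X = 0] and one for the trace; [(b + 1)^2 > b^2 + 1] uses
   [0 < b]. *)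
have lt : (b * b + 1 < r * r)%N.
  apply: leq_trans (leq_mul br br); rewrite mulSn mulnS !addSn; lia.
pose E (k : 'I_(r * r)) : 'M[C]_r := delta_mx (mxtens_unindex k).1 (mxtens_unindex k).2.
have [c [[k ck] ec]] := lin_dep (fun k => row_mx (mxvec (Phi (E k))) (\tr (E k))%:M) lt.
pose X := \sum_k c k *: E k.
have Phi0 : Phi 0 = 0 by rewrite -(scale0r 0) PhiZ scale0r.
have PX : Phi X = 0.
  rewrite /X (big_morph _ PhiD Phi0); apply/(can_inj mxvecK); rewrite linear0 linear_sum.
  move/(congr1 lsubmx): ec; rewrite linear0 linear_sum; apply: etrans.
  by apply: eq_bigr => i _; rewrite PhiZ !linearZ /= row_mxKl.
have tX : \tr X = 0.
  rewrite /X linear_sum; move/(congr1 rsubmx): ec; rewrite linear0 linear_sum => /matrixP/(_ 0 0); rewrite summxE.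
  rewrite [RHS]mxE; apply: etrans; apply: eq_bigr => i _.
  by rewrite !linearZ /= row_mxKr !mxE eqxx mulr1n.
have X0 : X != 0.
  apply/eqP => /matrixP/(_ (mxtens_unindex k).1 (mxtens_unindex k).2).
  rewrite /X summxE (bigD1 k) //= big1 ?addr0 => [|i ik].
    by rewrite !mxE !eqxx mulr1 => /eqP; apply/negP.
  rewrite !mxE; case: eqP => [e1|]; case: eqP => [e2|]; rewrite ?mulr0 //=.
  case/eqP: ik; apply: (can_inj (@mxtens_unindexK _ _)).
  by rewrite [LHS]surjective_pairing -e1 -e2.
(* The solution space is closed under adjoints. Hence [X + adj X] is a Hermitian solution, and if it
   is 0 then ['i X] is one. *)
have [h|h] := eqVneq (X + adj X) 0.
  exists ('i%C *: X); split; rewrite ?PhiZ ?PX ?scaler0 ?linearZ /= ?tX ?mulr0 //.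
    rewrite adjZ (_ : conjC _ = - 'i%C); last by rewrite -conjCi.
    by move/eqP: h; rewrite addr_eq0 => /eqP {2}->; rewrite scaleNr scalerN.
  by rewrite scaler_eq0 negb_or X0 andbT eq_complex /= oner_eq0 andbF.
exists (X + adj X); split; rewrite ?adjD ?adjK ?PhiD ?PhiA ?PX ?adj0 ?addr0 // 1?addrC //.
by rewrite linearD /= adj_tr tX rmorph0 addr0.
Qed.

(** The matrix [sqrt(a) U^*] has the required Gram matrix, and its row [i0] is zero and can be
    deleted. *)
Lemma gram_drop r (U : 'M[C]_r.+1) (a : 'rV[R]_r.+1) i0 :
  (forall i, 0 <= a 0 i) -> a 0 i0 = 0 ->
  exists L : 'M[C]_(r, r.+1), adj L *m L = U *m rdiag a *m adj U.
Proof.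
move=> a0 ai0; exists (row' i0 (rdiag (map_mx sqrtr a) *m adj U)).
have hL i y : row' i0 (rdiag (map_mx sqrtr a) *m adj U) i y =
    (sqrtr (a 0 (lift i0 i)))%:C * conjC (U y (lift i0 i)).
  by rewrite mxE mul_diag_mx mxE adjE !mxE.
apply/matrixP => x y; rewrite [RHS]mxE (bigD1_ord i0) //= mulmx_rdiagE ai0 mulr0 mul0r add0r.
rewrite mxE; apply: eq_bigr => i _.
rewrite mulmx_rdiagE !adjE !hL rmorphM /= conjC_realc conjCK.
rewrite -{3}(sqr_sqrtr (a0 (lift i0 i))) rmorphXn /=; ring.
Qed.

(* The two ends of the segment of positive matrices 1 + t X are singular, hence
   of the form L^* L with one row less; 1 is a convex combination of them. *)
Lemma dim_drop r b (Phi : 'M[C]_r.+1 -> 'M[C]_b) :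
  (forall X Y, Phi (X + Y) = Phi X + Phi Y) -> (forall c X, Phi (c *: X) = c *: Phi X) ->
  (forall X, Phi (adj X) = adj (Phi X)) -> (0 < b < r.+1)%N ->
  exists (s t : R) (L0 L1 : 'M[C]_(r, r.+1)),
   [/\ [/\ 0 <= s, 0 <= t & s + t = 1],
       s%:C *: (adj L0 *m L0) + t%:C *: (adj L1 *m L1) = 1%:M,
       Phi (adj L0 *m L0) = Phi 1%:M & Phi (adj L1 *m L1) = Phi 1%:M].
Proof.
move=> PhiD PhiZ PhiA br; have [X [hX X0 tX PX]] := herm_dep PhiD PhiZ PhiA br.
have [U [x h]] := herm_eigdec hX; have [u1 u2 eX] := h.
have sx : \sum_i x 0 i = 0.
  rewrite -[RHS](congr1 Re tX) -(diag_in_sum X u2); apply: eq_bigr => i _.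
  by rewrite (eigdec_diag_in i h).
have [j xj] : exists j, x 0 j != 0.
  apply: contrapT => /forallNP h0; case/eqP: X0; rewrite eX.
  suff -> : rdiag x = 0 by rewrite mulmx0 mul0mx.
  apply/matrixP => i k; rewrite !mxE; have /negP := h0 i; rewrite negbK => /eqP ->.
  by rewrite mul0rn.
(* The extreme eigenvalues have strictly opposite signs, since the eigenvalues sum to 0 and are not
   all 0. *)
have [i0 _ mn] := @arg_minP _ _ _ ord0 predT (fun i => x 0 i) isT.
have [i1 _ mx] := @arg_maxP _ _ _ ord0 predT (fun i => x 0 i) isT.
have neg : x 0 i0 < 0.
  rewrite ltNge; apply/negP => p; move/eqP: sx; rewrite psumr_eq0 => [/allP /(_ j)|i _].
    by rewrite mem_index_enum (negPf xj) => /(_ isT).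
  exact: le_trans p (mn i isT).
have pos : 0 < x 0 i1.
  rewrite ltNge; apply/negP => p; move/eqP: sx.
  rewrite -oppr_eq0 -sumrN psumr_eq0 => [/allP /(_ j)|i _].
    by rewrite mem_index_enum oppr_eq0 (negPf xj) => /(_ isT).
  by rewrite oppr_ge0; apply: le_trans p; apply: mx.
have D0 : 0 < x 0 i1 - x 0 i0 by lra.
have TE (w : R) : U *m rdiag (\row_i (1 + w * x 0 i)) *m adj U = 1%:M + w%:C *: X.
  have -> : rdiag (\row_i (1 + w * x 0 i)) = 1%:M + w%:C *: rdiag x.
    apply/matrixP => i k; rewrite !mxE; case: eqP => _; last by rewrite !mulr0n mulr0 addr0.
    by rewrite !mulr1n rmorphD rmorphM.
  by rewrite mulmxDr mulmxDl mulmx1 u2 -scalemxAr -scalemxAl -eX.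
(* [1 + w X] stays positive for [w] between [- 1 / x_max] and [- 1 / x_min]; at either end an
   extreme eigenvalue of [X] gives the eigenvalue 0. *)
have [||L0 e0] := @gram_drop r U (\row_i (1 + (- (x 0 i0))^-1 * x 0 i)) i0.
- move=> i; rewrite mxE; have : - x 0 i <= - x 0 i0 by rewrite lerN2; apply: mn.
  rewrite -(ler_pM2l (_ : 0 < (- x 0 i0)^-1)) ?invr_gt0 ?oppr_gt0 // mulVf ?oppr_eq0 ?lt_eqF //.
  by rewrite mulrN; lra.
- by rewrite mxE invrN mulNr mulVf ?lt_eqF // subrr.
have [||L1 e1] := @gram_drop r U (\row_i (1 + (- (x 0 i1)^-1) * x 0 i)) i1.
- move=> i; rewrite mxE; have : x 0 i <= x 0 i1 by apply: mx.
  rewrite -(ler_pM2l (_ : 0 < (x 0 i1)^-1)) ?invr_gt0 // mulVf ?gt_eqF //.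
  by rewrite mulNr; lra.
- by rewrite mxE mulNr mulVf ?gt_eqF // subrr.
(* The weights for which the two end parameters average to 0, so that [X] cancels from the
   combination. *)
exists (- x 0 i0 / (x 0 i1 - x 0 i0)), (x 0 i1 / (x 0 i1 - x 0 i0)), L0, L1.
split.
- split; [by rewrite divr_ge0 ?oppr_ge0 ?ltW|by rewrite divr_ge0 ?ltW|].
  by rewrite -mulrDl addrC divff ?gt_eqF.
- rewrite e0 e1 !TE !scalerDr !scalerA -!rmorphM addrACA -!scalerDl -!rmorphD /=.
  rewrite -mulrDl [- _ + _]addrC divff ?gt_eqF // scale1r.
  rewrite mulrAC divff ?oppr_eq0 ?lt_eqF // mulrN mulrAC divff ?gt_eqF // subrr.
  by rewrite scale0r addr0.
- by rewrite e0 TE PhiD PhiZ PX scaler0 addr0.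
by rewrite e1 TE PhiD PhiZ PX scaler0 addr0.
Qed.

Variables (dA b dC : nat) (rho : 'M[C]_(dA * b * dC)).
Hypotheses (prho : psd rho) (b0 : (0 < b)%N).

Lemma convex_min (s t x y z : R) : 0 <= s -> 0 <= t -> s + t = 1 ->
  s * x + t * y <= z -> x <= z \/ y <= z.
Proof.
move=> s0 t0 st h; case: (leP x z) => [|xz]; first by left.
case: (leP y z) => [|yz]; first by right.
have hx : s * z <= s * x by rewrite ler_wpM2l // ltW.
have hy : t * z <= t * y by rewrite ler_wpM2l // ltW.
have e : s * z + t * z = z by rewrite -mulrDl st mul1r.
have [s1|s1] := ltrP 0 s.
  have : s * z < s * x by rewrite ltr_pM2l.
  by lra.
have t1 : 0 < t by lra.
have : t * z < t * y by rewrite ltr_pM2l.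
by lra.
Qed.

Lemma pid_isom m n : (m <= n)%N -> adj (pid_mx m : 'M[C]_(n, m)) *m pid_mx m = 1%:M.
Proof.
move=> mn; rewrite /adj tr_pid_mx map_pid_mx mul_pid_mx !minnn (minn_idPr mn).
exact: pid_mx_1.
Qed.

(** The right dimension drops by one as long as it exceeds [b]; what is left is padded to exactly
    [b], so that all blocks get the same type. *)
Lemma cost_shrink_right l r (M : 'M[C]_(l * r, b)) :
  exists M' : 'M[C]_(l * b, b), adj M' *m M' = adj M *m M /\ cost rho M' <= cost rho M.
Proof.
have gr r1 r2 (L : 'M[C]_(r2, r1)) (N : 'M[C]_(l * r1, b)) :
    adj ((1%:M *t L) *m N) *m ((1%:M *t L) *m N) = adj N *m (1%:M *t (adj L *m L)) *m N.
  by rewrite adjM !mulmxA -(mulmxA _ (adj (_ *t _))) adj_tens tensmx_mul adj1 mulmx1.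
elim: r => [|r IH] in M *.
  exists ((1%:M *t (pid_mx 0 : 'M_(b, 0))) *m M).
  have e : adj (pid_mx 0 : 'M[C]_(b, 0)) *m pid_mx 0 = 1%:M by exact: pid_isom.
  by rewrite gr cost_right_isom // e tens11 mulmx1.
case: (leqP r.+1 b) => rb.
  exists ((1%:M *t (pid_mx r.+1 : 'M_(b, r.+1))) *m M).
  have e : adj (pid_mx r.+1 : 'M[C]_(b, r.+1)) *m pid_mx r.+1 = 1%:M by exact: pid_isom.
  by rewrite gr cost_right_isom // e tens11 mulmx1.
(* [Phi (L^* L)] is the Gram matrix of [(1%:M *t L) *m M]; moving along the kernel of [Phi]
   therefore preserves [M^* M]. *)
pose Phi (X : 'M[C]_r.+1) := adj M *m (1%:M *t X) *m M.
have [||||s [t [L0 [L1 [[s0 t0 st] eT P0 P1]]]]] := @dim_drop _ _ Phi.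
- by move=> X Y; rewrite /Phi tensDr mulmxDr mulmxDl.
- by move=> c X; rewrite /Phi tensZr -scalemxAr -scalemxAl.
- by move=> X; rewrite /Phi !adjM adjK adj_tens adj1 mulmxA.
- by rewrite b0.
have PE : Phi 1%:M = adj M *m M by rewrite /Phi tens11 mulmx1.
have e0 : adj ((1%:M *t L0) *m M) *m ((1%:M *t L0) *m M) = adj M *m M.
  by rewrite gr -/(Phi _) P0.
have e1 : adj ((1%:M *t L1) *m M) *m ((1%:M *t L1) *m M) = adj M *m M.
  by rewrite gr -/(Phi _) P1.
case: (convex_min s0 t0 st (cost_right_concave prho s0 t0 st eT e0 e1)) => le.
  have [M' [eM' leM']] := IH ((1%:M *t L0) *m M).
  by exists M'; split; [rewrite eM' e0|exact: le_trans leM' le].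
have [M' [eM' leM']] := IH ((1%:M *t L1) *m M).
by exists M'; split; [rewrite eM' e1|exact: le_trans leM' le].
Qed.

Lemma cost_shrink_left l r (M : 'M[C]_(l * r, b)) :
  exists M' : 'M[C]_(b * r, b), adj M' *m M' = adj M *m M /\ cost rho M' <= cost rho M.
Proof.
have gr l1 l2 (L : 'M[C]_(l2, l1)) (N : 'M[C]_(l1 * r, b)) :
    adj ((L *t 1%:M) *m N) *m ((L *t 1%:M) *m N) = adj N *m ((adj L *m L) *t 1%:M) *m N.
  by rewrite adjM !mulmxA -(mulmxA _ (adj (_ *t _))) adj_tens tensmx_mul adj1 mulmx1.
elim: l => [|l IH] in M *.
  exists (((pid_mx 0 : 'M_(b, 0)) *t 1%:M) *m M).
  have e : adj (pid_mx 0 : 'M[C]_(b, 0)) *m pid_mx 0 = 1%:M by exact: pid_isom.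
  by rewrite gr cost_left_isom // e tens11 mulmx1.
case: (leqP l.+1 b) => lb.
  exists (((pid_mx l.+1 : 'M_(b, l.+1)) *t 1%:M) *m M).
  have e : adj (pid_mx l.+1 : 'M[C]_(b, l.+1)) *m pid_mx l.+1 = 1%:M by exact: pid_isom.
  by rewrite gr cost_left_isom // e tens11 mulmx1.
pose Phi (X : 'M[C]_l.+1) := adj M *m (X *t 1%:M) *m M.
have [||||s [t [L0 [L1 [[s0 t0 st] eT P0 P1]]]]] := @dim_drop _ _ Phi.
- by move=> X Y; rewrite /Phi tensDl mulmxDr mulmxDl.
- by move=> c X; rewrite /Phi tensZl -scalemxAr -scalemxAl.
- by move=> X; rewrite /Phi !adjM adjK adj_tens adj1 mulmxA.
- by rewrite b0.
have PE : Phi 1%:M = adj M *m M by rewrite /Phi tens11 mulmx1.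
have e0 : adj ((L0 *t 1%:M) *m M) *m ((L0 *t 1%:M) *m M) = adj M *m M.
  by rewrite gr -/(Phi _) P0.
have e1 : adj ((L1 *t 1%:M) *m M) *m ((L1 *t 1%:M) *m M) = adj M *m M.
  by rewrite gr -/(Phi _) P1.
case: (convex_min s0 t0 st (cost_left_concave prho s0 t0 st eT e0 e1)) => le.
  have [M' [eM' leM']] := IH ((L0 *t 1%:M) *m M).
  by exists M'; split; [rewrite eM' e0|exact: le_trans leM' le].
have [M' [eM' leM']] := IH ((L1 *t 1%:M) *m M).
by exists M'; split; [rewrite eM' e1|exact: le_trans leM' le].
Qed.

Lemma amplZ l r c (M : 'M[C]_(l * r, b)) : ampl dA dC (c *: M) = c *: ampl dA dC M.
Proof.
rewrite /ampl /ampl3 tensZr tensZl.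
by apply/matrixP => i j; rewrite castmxE mxE [RHS]mxE castmxE.
Qed.

Lemma sigZ l r (w : R) (M : 'M[C]_(l * r, b)) :
  sig rho (w%:C *: M) = (w ^+ 2)%:C *: sig rho M.
Proof.
by rewrite /sig amplZ adjZ conjC_realc -!scalemxAl -scalemxAr scalerA -rmorphM -expr2.
Qed.

(** Each of the two entropies contributes [- xlnx w * q] and the term [xlnx (w q)] gives one copy
    back, so that exactly one remains. *)
Lemma costZ l r (w : R) (M : 'M[C]_(l * r, b)) : 0 <= w ->
  cost rho ((sqrtr w)%:C *: M) = w * cost rho M - xlnx w * Re (\tr (sig rho M)).
Proof.
move=> w0; rewrite /cost sigZ sqr_sqrtr // ptr_sndZ ptr_fstZ linearZ /= ReMl.
have ps := psd_sig prho M.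
rewrite !vnent_scale //; [|exact: psd_ptr_fst|exact: psd_ptr_snd].
rewrite mxtrace_ptr_sndE mxtrace_ptr_fstE.
have := Re_ge0 (psd_tr ps); move: (Re (\tr _)) => q; rewrite le_eqVlt => /predU1P[<-|q0].
  by rewrite /xlnx !(mulr0, mul0r, subr0, addr0) mulrDr.
rewrite /xlnx; move: w0; rewrite le_eqVlt => /predU1P[<-|w0]; first by rewrite !(mul0r, subr0, addr0).
by rewrite lnM ?posrE //; ring.
Qed.

Lemma cost0 l r : cost rho (0 : 'M[C]_(l * r, b)) = 0.
Proof.
have e : (sqrtr (0 : R))%:C *: (0 : 'M[C]_(l * r, b)) = 0 by rewrite scaler0.
by rewrite -e costZ // /xlnx !mul0r subr0.
Qed.

Lemma family_drop k l r (M : 'I_k.+1 -> 'M[C]_(l * r, b)) j : M j = 0 ->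
  \sum_i adj (M (lift j i)) *m M (lift j i) = \sum_i adj (M i) *m M i /\
  \sum_i cost rho (M (lift j i)) = \sum_i cost rho (M i).
Proof.
move=> Mj; split; rewrite [RHS](bigD1_ord j) //= Mj.
  by rewrite mulmx0 add0r.
by rewrite cost0 add0r.
Qed.

(** A complex relation exists by counting entries. As the [H j] are Hermitian, the conjugate
    coefficients satisfy it too, hence so do the real parts of [c] and of ['i c]; one of these is
    nonzero at [j]. *)
Lemma real_dep k (H : 'I_k -> 'M[C]_b) : (forall j, adj (H j) = H j) -> (b * b < k)%N ->
  exists d : 'I_k -> R, (exists j, d j != 0) /\ \sum_j (d j)%:C *: H j = 0.
Proof.
move=> hH bk; have [c [[j cj] ec]] := lin_dep (fun j => mxvec (H j)) bk.
have eH (c' : C) : \sum_j (c' * c j) *: H j = 0.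
  apply/(can_inj mxvecK); rewrite linear0 linear_sum -[RHS](scaler0 _ c') -[in RHS]ec scaler_sumr.
  by apply: eq_bigr => i _; rewrite linearZ /= scalerA.
have key (c' : C) : \sum_j (Re (c' * c j))%:C *: H j = 0.
  have e2 : \sum_j conjC (c' * c j) *: H j = 0.
    transitivity (adj (\sum_j (c' * c j) *: H j)); last by rewrite eH adj0.
    by rewrite adj_sum; apply: eq_bigr => i _; rewrite adjZ hH.
  have : \sum_j ((c' * c j) + conjC (c' * c j)) *: H j = 0.
    by under eq_bigr do rewrite scalerDl; rewrite big_split /= eH e2 addr0.
  under eq_bigr => i _.
    rewrite (_ : _ + _ = 2 * (Re (c' * c i))%:C) -?scalerA; last exact: addcJ.
    over.
  rewrite -scaler_sumr => /eqP; rewrite scaler_eq0 pnatr_eq0 /= => /eqP.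
  by [].
have [h|h] := eqVneq (Re (c j)) 0; last first.
  exists (fun j => Re (c j)); split; first by exists j.
  by rewrite -[RHS](key 1); apply: eq_bigr => i _; rewrite mul1r.
exists (fun j => Re ('i%C * c j)); split; last exact: key.
exists j; apply: contraNneq cj; case: (c j) h => x y /= ->.
by rewrite mul0r mul1r sub0r => /eqP; rewrite oppr_eq0 => /eqP ->.
Qed.

(* The cost is not homogeneous: cost (sqrt w M) = w cost M - q w ln w, which is
   concave in w and lies below its tangent at w = 1. *)
Lemma family_reweight k l r (M : 'I_k.+1 -> 'M[C]_(l * r, b)) (w : 'I_k.+1 -> R) j :
  (forall i, 0 <= w i) -> w j = 0 ->
  exists M' : 'I_k -> 'M[C]_(l * r, b),
    \sum_i adj (M' i) *m M' i = \sum_i (w i)%:C *: (adj (M i) *m M i) /\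
    \sum_i cost rho (M' i) <=
      \sum_i (w i * cost rho (M i) + (1 - w i) * Re (\tr (sig rho (M i)))).
Proof.
move=> w0 wj; pose N i := (sqrtr (w i))%:C *: M i.
have Nj : N j = 0 by rewrite /N wj sqrtr0 scale0r.
have [e1 e2] := family_drop Nj; exists (fun i => N (lift j i)); rewrite e1 e2; split.
  apply: eq_bigr => i _.
  by rewrite adjZ conjC_realc -scalemxAl -scalemxAr scalerA -rmorphM -expr2 sqr_sqrtr.
apply: ler_sum => i _; rewrite costZ // lerD2l -mulNr ler_wpM2r //.
  by rewrite Re_ge0 // psd_tr //; apply: psd_sig.
by have := klein_scalar (w0 i) ltr01; rewrite ln1 mulr0 subr0.
Qed.

(** A real relation [d] among the Gram matrices leaves their sum unchanged under the weights
    [1 + c d_i]. At both ends of the admissible range of [c] a weight vanishes, and since the bounds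
    of [family_reweight] are affine in [c], one end costs no more than [c = 0]. *)
Lemma family_step k l r (M : 'I_k.+1 -> 'M[C]_(l * r, b)) : (b * b < k.+1)%N ->
  exists M' : 'I_k -> 'M[C]_(l * r, b),
    \sum_i adj (M' i) *m M' i = \sum_i adj (M i) *m M i /\
    \sum_i cost rho (M' i) <= \sum_i cost rho (M i).
Proof.
move=> bk; have [[j Mj]|/forallNP Mn] := pselect (exists j, M j = 0).
  by have [e1 e2] := family_drop Mj; exists (fun i => M (lift j i)); rewrite e1 e2.
pose H j := adj (M j) *m M j.
have pH j : psd (H j) by rewrite /H -{2}[M j]adjK; apply: psd_adj.
(* With zero blocks excluded all Gram traces are positive, so the trace of the relation forces
   coefficients [d] of both signs. *)
have tH j : 0 < Re (\tr (H j)).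
  rewrite lt_def Re_ge0 ?psd_tr // andbT; apply/eqP => /(psd_retr0 (pH j)).
  rewrite /H -{2}[M j]adjK => /(congr1 (@mxtrace _ _)); rewrite mxtrace0 => /mxtrace_adj_eq0 e.
  by apply: (Mn j); rewrite -[M j]adjK e adj0.
have [d [[j1 dj1] ed]] := real_dep (fun j => psd_herm (pH j)) bk.
have sd : \sum_j d j * Re (\tr (H j)) = 0.
  transitivity (Re (\tr (\sum_j (d j)%:C *: H j))); last by rewrite ed mxtrace0.
  have -> : \tr (\sum_j (d j)%:C *: H j) = \sum_j \tr ((d j)%:C *: H j) by rewrite linear_sum.
  by rewrite Re_sum; apply: eq_bigr => i _; rewrite linearZ /= ReMl.
have [i0 _ mn] := @arg_minP _ _ _ ord0 predT d isT.
have [i1 _ mx] := @arg_maxP _ _ _ ord0 predT d isT.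
have neg : d i0 < 0.
  rewrite ltNge; apply/negP => p; move/eqP: sd; rewrite psumr_eq0 => [/allP /(_ j1)|i _].
    by rewrite mem_index_enum mulf_eq0 (negPf dj1) gt_eqF // => /(_ isT).
  by rewrite mulr_ge0 ?(le_trans p (mn i isT)) // ltW.
have pos : 0 < d i1.
  rewrite ltNge; apply/negP => p; move/eqP: sd; rewrite -oppr_eq0 -sumrN.
  rewrite psumr_eq0 => [/allP /(_ j1)|i _].
    by rewrite mem_index_enum oppr_eq0 mulf_eq0 (negPf dj1) gt_eqF // => /(_ isT).
  by rewrite oppr_ge0 mulr_le0_ge0 ?(le_trans (mx i isT) p) // ltW.
have D0 : 0 < d i1 - d i0 by lra.
have eH (c : R) : \sum_i (1 + c * d i)%:C *: H i = \sum_i H i.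
  under eq_bigr do rewrite rmorphD rmorphM scalerDl scale1r -scalerA.
  by rewrite big_split /= -scaler_sumr ed scaler0 addr0.
pose u := (- d i0)^-1; pose v := - (d i1)^-1.
have [||M0 [e0 le0]] := @family_reweight _ _ _ M (fun i => 1 + u * d i) i0.
- move=> i; have : - d i <= - d i0 by rewrite lerN2; apply: mn.
  rewrite -(ler_pM2l (_ : 0 < u)) ?invr_gt0 ?oppr_gt0 // /u mulVf ?oppr_eq0 ?lt_eqF //.
  by rewrite mulrN; lra.
- by rewrite /u invrN mulNr mulVf ?lt_eqF // subrr.
have [||M1 [e1 le1]] := @family_reweight _ _ _ M (fun i => 1 + v * d i) i1.
- move=> i; have : d i <= d i1 by apply: mx.
  rewrite -(ler_pM2l (_ : 0 < (d i1)^-1)) ?invr_gt0 // mulVf ?gt_eqF //.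
  by rewrite /v mulNr; lra.
- by rewrite /v mulNr mulVf ?gt_eqF // subrr.
pose s := - d i0 / (d i1 - d i0); pose t := d i1 / (d i1 - d i0).
have s0 : 0 <= s by rewrite divr_ge0 ?oppr_ge0 ?ltW.
have t0 : 0 <= t by rewrite divr_ge0 ?ltW.
have st : s + t = 1 by rewrite -mulrDl addrC divff ?gt_eqF.
have suv : s * u + t * v = 0.
  rewrite /s /t /u /v mulrAC divff ?oppr_eq0 ?lt_eqF // mulrN mulrAC divff ?gt_eqF //.
  by rewrite subrr.
have cvx : s * \sum_i cost rho (M0 i) + t * \sum_i cost rho (M1 i) <= \sum_i cost rho (M i).
  apply: (le_trans (lerD (ler_wpM2l s0 le0) (ler_wpM2l t0 le1))).
  rewrite !mulr_sumr -big_split; apply: ler_sum => i _ /=.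
  move: (cost _ _) (Re _) => x q; rewrite le_eqVlt; apply/orP; left; apply/eqP.
  transitivity ((s + t) * x + (s * u + t * v) * (d i * (x - q))); first by ring.
  by rewrite st suv mul1r mul0r addr0.
case: (convex_min s0 t0 st cvx) => le; [exists M0|exists M1]; split=> //.
  by rewrite e0 eH.
by rewrite e1 eH.
Qed.

Lemma family_shrink k l r (M : 'I_k -> 'M[C]_(l * r, b)) :
  exists M' : 'I_(b ^ 2) -> 'M[C]_(l * r, b),
    \sum_i adj (M' i) *m M' i = \sum_i adj (M i) *m M i /\
    \sum_i cost rho (M' i) <= \sum_i cost rho (M i).
Proof.
elim: k => [|k IH] in M *; last first.
  case: (ltnP (b * b) k.+1) => [bk|kb].
    have [M1 [e1 le1]] := family_step M bk; have [M2 [e2 le2]] := IH M1.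
    by exists M2; rewrite e2 e1; split=> //; apply: le_trans le1.
  (* Too few blocks are padded with zero matrices, which have zero Gram matrix and zero cost. *)
  pose N (i : nat) := if insub i is Some j then M j else 0.
  have pad (V : nmodType) (f : 'M[C]_(l * r, b) -> V) : f 0 = 0 ->
      \sum_(i < b ^ 2) f (N i) = \sum_i f (M i).
    move=> f0; rewrite -[(b ^ 2)%N]/(b * b)%N.
    transitivity (\sum_(i < k.+1) f (N i)); last first.
      by apply: eq_bigr => i _; rewrite /N valK.
    rewrite (big_ord_widen (b * b) (fun i => f (N i)) kb) [RHS]big_mkcond /=.
    by apply: eq_bigr => i _; case: ifP => // ik; rewrite /N insubF.
  exists (fun i => N i).
  rewrite (pad _ (fun X => adj X *m X)) ?mulmx0 //.
  by rewrite (pad R (fun X => cost rho X)) // cost0.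
exists (fun _ => 0); rewrite !big_ord0; split.
  by rewrite big1 // => i _; rewrite mulmx0.
by rewrite big1 // => i _; rewrite cost0.
Qed.

Lemma family_reduce k (l r : 'I_k -> nat) (M : forall j, 'M[C]_(l j * r j, b)) :
  exists M' : 'I_(b ^ 2) -> 'M[C]_(b * b, b),
    \sum_i adj (M' i) *m M' i = \sum_i adj (M i) *m M i /\
    \sum_i cost rho (M' i) <= \sum_i cost rho (M i).
Proof.
have h j : exists M' : 'M[C]_(b * b, b),
    adj M' *m M' = adj (M j) *m M j /\ cost rho M' <= cost rho (M j).
  have [M1 [e1 le1]] := cost_shrink_right (M j); have [M2 [e2 le2]] := cost_shrink_left M1.
  by exists M2; rewrite e2 e1; split=> //; apply: le_trans le1.
have [N hN] := choice h; have [M' [e le]] := family_shrink N.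
exists M'; split; first by rewrite e; apply: eq_bigr => i _; exact: (hN i).1.
by apply: (le_trans le); apply: ler_sum => i _; exact: (hN i).2.
Qed.

End Reduction.

(** * Relative entropy to Markov states *)

Section ProductLog.
Variable R : realType.
Local Notation C := R[i].
Local Notation Re := (@complex.Re R).

Definition tens_row m n (a : 'rV[R]_m) (c : 'rV[R]_n) : 'rV[R]_(m * n) :=
  \row_k (a 0 (mxtens_unindex k).1 * c 0 (mxtens_unindex k).2).

Lemma eigdec_tens m n (A U : 'M[C]_m) (B W : 'M[C]_n) a c :
  eigdec A U a -> eigdec B W c -> eigdec (A *t B) (U *t W) (tens_row a c).
Proof.
case=> u1 u2 eA [w1 w2 eB]; split; rewrite ?adj_tens ?tensmx_mul ?u1 ?u2 ?w1 ?w2 ?tens11 //.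
rewrite {1}eA {1}eB -!tensmx_mul; congr (_ *m _ *m _).
apply/matrixP => i j; case: (mxtens_indexP i) => x y; case: (mxtens_indexP j) => x' y'.
rewrite tensmxE !mxE !mxtens_indexK (can_eq (@mxtens_indexK _ _)) xpair_eqE /= rmorphM.
by case: eqP; case: eqP; rewrite ?(mulr0n, mulr1n, mul0r, mulr0).
Qed.

Lemma diag_in_ptr_snd m n (U : 'M[C]_m) (W : 'M[C]_n) (S : 'M[C]_(m * n)) x : W *m adj W = 1%:M ->
  \sum_y diag_in (U *t W) S (mxtens_index (x, y)) = diag_in U (ptr_snd S) x.
Proof.
move=> w; have := ptr_snd_conj (adj U) (adj W) S; rewrite !adjK w tens11 mul1mx adj_tens !adjK => e.
by rewrite /diag_in -e mxE Re_sum; apply: eq_bigr => y _; rewrite adj_tens.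
Qed.

Lemma diag_in_ptr_fst m n (U : 'M[C]_m) (W : 'M[C]_n) (S : 'M[C]_(m * n)) y : U *m adj U = 1%:M ->
  \sum_x diag_in (U *t W) S (mxtens_index (x, y)) = diag_in W (ptr_fst S) y.
Proof.
move=> u; have := ptr_fst_conj (adj U) (adj W) S; rewrite !adjK u tens11 mul1mx adj_tens !adjK => e.
by rewrite /diag_in -e mxE Re_sum; apply: eq_bigr => x _; rewrite adj_tens.
Qed.

Section Block.
Variables (m n : nat) (muL U : 'M[C]_m) (muR W : 'M[C]_n) (a : 'rV[R]_m) (c : 'rV[R]_n).
Variables (p : R) (S : 'M[C]_(m * n)).
Hypotheses (hL : eigdec muL U a) (hR : eigdec muR W c) (p0 : 0 <= p).
Hypotheses (pL : psd muL) (pR : psd muR) (pS : psd S).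
(** Support inclusion in coordinates: [S] has no weight on the product eigenvectors in the kernel of
    [p (muL *t muR)]. *)
Hypothesis supp : forall x y, p * (a 0 x * c 0 y) = 0 -> diag_in (U *t W) S (mxtens_index (x, y)) = 0.

Let d x y := diag_in (U *t W) S (mxtens_index (x, y)).
Let q := Re (\tr S).

Let a0 x : 0 <= a 0 x. Proof. exact: psd_eigdec pL hL. Qed.
Let c0 y : 0 <= c 0 y. Proof. exact: psd_eigdec pR hR. Qed.
Let sumL x : \sum_y d x y = diag_in U (ptr_snd S) x.
Proof. by case: hR => _ w _; exact: diag_in_ptr_snd. Qed.
Let sumR y : \sum_x d x y = diag_in W (ptr_fst S) y.
Proof. by case: hL => _ u _; exact: diag_in_ptr_fst. Qed.
Let sumLq : \sum_x diag_in U (ptr_snd S) x = q.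
Proof. by case: hL => _ u _; rewrite (diag_in_sum _ u) mxtrace_ptr_sndE. Qed.

(** The logarithm of a product of eigenvalues splits only if none of them is 0; elsewhere [supp]
    makes the coefficient [d x y] vanish. *)
Lemma tr_log_product : Re (\tr (S *m logm (p%:C *: (muL *t muR)))) =
  q * ln p + \sum_x ln (a 0 x) * diag_in U (ptr_snd S) x + \sum_y ln (c 0 y) * diag_in W (ptr_fst S) y.
Proof.
rewrite (tr_cfun _ _ (eigdecZ p (eigdec_tens hL hR))) sum_tens.
transitivity (\sum_x \sum_y (ln p * d x y + ln (a 0 x) * d x y + ln (c 0 y) * d x y)).
  apply: eq_bigr => x _; apply: eq_bigr => y _; rewrite -/(d x y) !mxE mxtens_indexK /=.
  have [e|/eqP] := pselect (p * (a 0 x * c 0 y) = 0).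
    by rewrite /d supp // !mulr0 !addr0.
  rewrite !mulf_eq0 !negb_or => /and3P[pn an cn].
  have pp : 0 < p by rewrite lt_def pn p0.
  have ap : 0 < a 0 x by rewrite lt_def an a0.
  have cp : 0 < c 0 y by rewrite lt_def cn c0.
  by rewrite !lnM ?posrE ?mulr_gt0 // addrA !mulrDl.
under eq_bigr do rewrite !big_split -!mulr_sumr sumL /=.
rewrite !big_split -mulr_sumr sumLq mulrC; congr (_ + _).
by rewrite exchange_big; apply: eq_bigr => y _; rewrite -mulr_sumr sumR.
Qed.

Hypotheses (trL : \tr muL = 1) (trR : \tr muR = 1).

(** Klein three times: each marginal against its reference state scaled by [q], so that the linear
    terms cancel, and the scalar [q] against [p], which leaves [p - q]. *)
Lemma tr_log_product_le : Re (\tr (S *m logm (p%:C *: (muL *t muR)))) <=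
  p - q - (vnent (ptr_snd S) + vnent (ptr_fst S) + xlnx q).
Proof.
have q0 : 0 <= q by rewrite Re_ge0 // psd_tr.
have dL0 x : 0 <= diag_in U (ptr_snd S) x by apply: diag_in_ge0; exact: psd_ptr_snd.
have dR0 y : 0 <= diag_in W (ptr_fst S) y by apply: diag_in_ge0; exact: psd_ptr_fst.
have d0 x y : 0 <= d x y by exact: diag_in_ge0.
have ea : \sum_x a 0 x = 1.
  case: hL => _ u _; rewrite -[RHS](congr1 Re trL) -(diag_in_sum _ u).
  by apply: eq_bigr => x _; rewrite (eigdec_diag_in _ hL).
have ec : \sum_y c 0 y = 1.
  case: hR => _ w _; rewrite -[RHS](congr1 Re trR) -(diag_in_sum _ w).
  by apply: eq_bigr => y _; rewrite (eigdec_diag_in _ hR).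
have kk k (X V : 'M[C]_k) (e : 'rV[R]_k) : psd X -> adj V *m V = 1%:M -> V *m adj V = 1%:M ->
    Re (\tr X) = q -> (forall i, 0 <= e 0 i) -> \sum_i e 0 i = 1 ->
    (forall i, e 0 i = 0 -> diag_in V X i = 0) ->
    \sum_i ln (e 0 i) * diag_in V X i <= - vnent X - xlnx q.
  move=> pX v1 v2 tX e0 e1 eX.
  have dX : \sum_i diag_in V X i = q by rewrite (diag_in_sum _ v2).
  have dX0 i : 0 <= diag_in V X i by exact: diag_in_ge0.
  have z i : q * e 0 i = 0 -> diag_in V X i = 0.
    move/eqP; rewrite mulf_eq0 => /orP[/eqP qz|/eqP /eX //].
    by apply/eqP; rewrite eq_le dX0 andbT -qz -dX (bigD1 i) //= lerDl sumr_ge0.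
  have := klein pX v1 v2 (fun i => mulr_ge0 q0 (e0 i)) z.
  rewrite !big_split /= !sumrN -mulr_sumr e1 mulr1 dX subrr add0r.
  have -> : \sum_i diag_in V X i * ln (q * e 0 i) = xlnx q + \sum_i ln (e 0 i) * diag_in V X i.
    have -> : xlnx q = \sum_i diag_in V X i * ln q by rewrite -mulr_suml dX.
    rewrite -big_split; apply: eq_bigr => i _ /=.
    have [/z ->|/eqP] := pselect (q * e 0 i = 0); first by rewrite !mul0r mulr0 addr0.
    rewrite mulf_eq0 negb_or => /andP[qn en].
    have qp : 0 < q by rewrite lt_def qn.
    have ep : 0 < e 0 i by rewrite lt_def en e0.
    by rewrite lnM ?posrE // mulrDr [_ * ln (e 0 i)]mulrC.
  lra.
rewrite tr_log_product.
have hl : \sum_x ln (a 0 x) * diag_in U (ptr_snd S) x <= - vnent (ptr_snd S) - xlnx q.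
  case: (hL) => u1 u2 _; apply: kk => //; first exact: psd_ptr_snd.
    by rewrite mxtrace_ptr_sndE.
  by move=> x ax; rewrite -sumL big1 // => y _; rewrite /d supp // ax mul0r mulr0.
have hr : \sum_y ln (c 0 y) * diag_in W (ptr_fst S) y <= - vnent (ptr_fst S) - xlnx q.
  case: (hR) => w1 w2 _; apply: kk => //; first exact: psd_ptr_fst.
    by rewrite mxtrace_ptr_fstE.
  by move=> y cy; rewrite -sumR big1 // => x _; rewrite /d supp // cy !mulr0.
have hp : q * ln p - xlnx q <= p - q.
  have := p0; rewrite le_eqVlt => /predU1P[pz|pp]; last first.
    by have := klein_scalar q0 pp; lra.
  have -> : q = 0.
    rewrite -sumLq big1 // => x _; rewrite -sumL big1 // => y _.
    by rewrite /d supp // -pz mul0r.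
  by rewrite /xlnx !mul0r -pz; lra.
by lra.
Qed.
End Block.

(** The equality case of [tr_log_product_le], with [p = q] and the normalised marginals. The support
    condition is automatic, since a vanishing diagonal entry of a marginal is a sum of nonnegative
    diagonal entries of [S]. Nothing is divided by [q], which may be 0. *)
Lemma tr_log_marginals m n (muL U : 'M[C]_m) (muR W : 'M[C]_n) a c (S : 'M[C]_(m * n)) :
  let q := Re (\tr S) in
  eigdec muL U a -> eigdec muR W c -> psd muL -> psd muR -> psd S ->
  ptr_snd S = q%:C *: muL -> ptr_fst S = q%:C *: muR ->
  (forall x y, q * (a 0 x * c 0 y) = 0 -> diag_in (U *t W) S (mxtens_index (x, y)) = 0) /\
  Re (\tr (S *m logm (q%:C *: (muL *t muR)))) = - (vnent (ptr_snd S) + vnent (ptr_fst S) + xlnx q).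
Proof.
move=> q hL hR pL pR pS eL eR.
have q0 : 0 <= q by rewrite Re_ge0 // psd_tr.
have [_ u _] := hL; have [_ w _] := hR.
have d0 k : 0 <= diag_in (U *t W) S k by exact: diag_in_ge0.
have dl x : diag_in U (ptr_snd S) x = q * a 0 x by rewrite eL diag_inZ (eigdec_diag_in _ hL).
have dr y : diag_in W (ptr_fst S) y = q * c 0 y by rewrite eR diag_inZ (eigdec_diag_in _ hR).
have supp x y : q * (a 0 x * c 0 y) = 0 -> diag_in (U *t W) S (mxtens_index (x, y)) = 0.
  move/eqP; rewrite mulrA mulf_eq0 => h; apply/eqP; rewrite eq_le d0 andbT.
  case/orP: h => /eqP e.
    by rewrite -e -dl -(diag_in_ptr_snd U S x w) (bigD1 y) //= lerDl sumr_ge0.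
  rewrite (_ : 0 = diag_in W (ptr_fst S) y); last by rewrite dr e mulr0.
  by rewrite -(diag_in_ptr_fst W S y u) (bigD1 x) //= lerDl sumr_ge0.
split=> //; rewrite (tr_log_product hL hR q0 pL pR supp) -/q.
have ent k (mu V : 'M[C]_k) e X : eigdec mu V e -> psd mu -> X = q%:C *: mu -> Re (\tr X) = q ->
    \sum_i ln (e 0 i) * diag_in V X i = - vnent X - xlnx q.
  move=> h pm eX tX; have [_ v _] := h; rewrite {2}eX vnent_scale // (vnent_eig h) mulrN opprB.
  have -> : \sum_i ln (e 0 i) * diag_in V X i = q * \sum_i xlnx (e 0 i).
    rewrite mulr_sumr; apply: eq_bigr => i _; rewrite eX diag_inZ (eigdec_diag_in _ h) /xlnx; ring.
  have -> : xlnx q * Re (\tr mu) = xlnx q.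
    move: tX; rewrite eX linearZ /= ReMl => e1; rewrite /xlnx mulrAC.
    by rewrite e1.
  by rewrite opprK addrAC subrr add0r.
rewrite (ent _ _ _ _ _ hL pL eL) ?mxtrace_ptr_sndE // (ent _ _ _ _ _ hR pR eR) ?mxtrace_ptr_fstE //.
by rewrite /xlnx; lra.
Qed.

Lemma diag_in_gram0 m n (K : 'M[C]_(n, m)) (V : 'M[C]_n) k :
  diag_in V (K *m adj K) k = 0 -> forall i, (adj K *m V) i k = 0.
Proof.
move=> h i; have e : (adj V *m (K *m adj K) *m V) k k = \sum_j `|(adj K *m V) j k| ^+ 2.
  rewrite (_ : _ *m V = adj (adj K *m V) *m (adj K *m V)); last first.
    by rewrite adjM adjK !mulmxA.
  by rewrite mxE; apply: eq_bigr => j _; rewrite adjE normCKC.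
have : \sum_j `|(adj K *m V) j k| ^+ 2 = 0.
  rewrite -e -[LHS]psd_re -/(diag_in _ _ _) ?h // e; apply: sumr_ge0 => j _.
  by rewrite exprn_ge0.
move/eqP; rewrite psumr_eq0 => [/allP /(_ i)|j _]; last by rewrite exprn_ge0.
by rewrite mem_index_enum expf_eq0 normr_eq0 /= => /(_ isT) /eqP.
Qed.

(** In the eigenbasis of [B], [v] has no component where the eigenvalue is nonzero, and [adj K]
    kills the eigenvectors with eigenvalue 0. *)
Lemma block_supp m n (B V : 'M[C]_n) (e : 'rV[R]_n) (K : 'M[C]_(n, m)) (v : 'cV[C]_n) :
  eigdec B V e -> (forall k, e 0 k = 0 -> diag_in V (K *m adj K) k = 0) ->
  B *m v = 0 -> adj K *m v = 0.
Proof.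
move=> [v1 v2 eB] h Bv.
have du : rdiag e *m (adj V *m v) = 0.
  by rewrite -[LHS]mul1mx -v1 -mulmxA (mulmxA V) (mulmxA _ (adj V)) -eB Bv mulmx0.
have -> : adj K *m v = (adj K *m V) *m (adj V *m v).
  by rewrite !mulmxA -(mulmxA _ V) v2 mulmx1.
apply/colP => i; rewrite [RHS]mxE mxE big1 // => k _.
move/matrixP/(_ k 0): du; rewrite mul_diag_mx mxE [RHS]mxE mxE => /eqP.
rewrite mulf_eq0 => /orP[/eqP /complexI /h /diag_in_gram0 ->|/eqP ->]; first by rewrite mul0r.
by rewrite mulr0.
Qed.
End ProductLog.

Section Markov.
Variable R : realType.
Local Notation C := R[i].
Local Notation Re := (@complex.Re R).

Lemma Re_tr_sum n I (r : seq I) (P : pred I) (F : I -> 'M[C]_n) :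
  Re (\tr (\sum_(i <- r | P i) F i)) = \sum_(i <- r | P i) Re (\tr (F i)).
Proof.
have -> : \tr (\sum_(i <- r | P i) F i) = \sum_(i <- r | P i) \tr (F i) by rewrite raddf_sum.
exact: Re_sum.
Qed.

Lemma castmx_rowM m m' n p (e : m = m') (A : 'M[C]_(m, n)) (B : 'M[C]_(n, p)) :
  castmx (e, erefl) A *m B = castmx (e, erefl) (A *m B).
Proof. by case: m' / e. Qed.

Lemma psd_tens m n (A : 'M[C]_m) (B : 'M[C]_n) : psd A -> psd B -> psd (A *t B).
Proof.
move=> /psd_sqrt[X ->] /psd_sqrt[Y ->].
by rewrite -tensmx_mul -adj_tens; apply: psd_adj.
Qed.

Lemma psd_sum n I (r : seq I) (P : pred I) (F : I -> 'M[C]_n) :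
  (forall i, P i -> psd (F i)) -> psd (\sum_(i <- r | P i) F i).
Proof. by move=> h; apply: big_ind; [exact: psd0|exact: psdD|exact: h]. Qed.

(** * States that are block diagonal along a decomposition *)

Section Decomp.
Variables (dX dY dZ : nat) (D : decomp R dY).
Hypothesis oD : orth_decomp D.

(** A coisometry onto block [j] with the regrouping built in, so that [muL j *t muR j] can be
    conjugated by it without casts. *)
Definition block_proj j : 'M[C]_(dX * dl D j * (dr D j * dZ), dX * dY * dZ) :=
  ampl3 (1%:M : 'M_dX) (adj (demb D j)) (1%:M : 'M_dZ).

Lemma blockW_proj j (B : 'M[C]_(dX * dl D j * (dr D j * dZ))) :
  @blockW R dX dY dZ D j *m castmx (tens_assoc_eq _ _ _ _, tens_assoc_eq _ _ _ _) B
    *m adj (@blockW R dX dY dZ D j) = adj (block_proj j) *m B *m block_proj j.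
Proof.
have -> : adj (block_proj j) = castmx (erefl, esym (tens_assoc_eq _ _ _ _)) (@blockW R dX dY dZ D j).
  by rewrite /block_proj /ampl3 adj_castmx !adj_tens !adj1 adjK.
have -> : block_proj j = castmx (esym (tens_assoc_eq _ _ _ _), erefl) (adj (@blockW R dX dY dZ D j)).
  by rewrite /block_proj /ampl3 /blockW !adj_tens !adj1.
move: (blockW _ _ _) (tens_assoc_eq _ _ _ _) => W e.
by case: _ / e in W *; rewrite !castmx_id.
Qed.

Lemma block_proj_mul i j : block_proj i *m adj (block_proj j) =
  castmx (esym (tens_assoc_eq _ _ _ _), esym (tens_assoc_eq _ _ _ _))
    ((1%:M *t (adj (demb D i) *m demb D j)) *t 1%:M).
Proof.
rewrite /block_proj /ampl3 adj_castmx -castmx_mul !adj_tens !adj1 adjK !tensmx_mul.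
by rewrite !mulmx1.
Qed.

Lemma block_proj_diag j : block_proj j *m adj (block_proj j) = 1%:M.
Proof.
have [iso _] := oD; rewrite block_proj_mul iso !tens11.
by case: _ / (esym (tens_assoc_eq _ _ _ _)) {2}(esym (tens_assoc_eq _ _ _ _)) => e; rewrite castmx_id.
Qed.

Lemma block_proj_off i j : i != j -> block_proj i *m adj (block_proj j) = 0.
Proof.
move=> ij; have [_ [off _]] := oD; rewrite block_proj_mul off // tensmx0 tens0mx.
by apply/matrixP => x y; rewrite castmxE !mxE.
Qed.

Lemma block_proj_sum : \sum_j adj (block_proj j) *m block_proj j = 1%:M.
Proof.
have [_ [_ tot]] := oD.
pose T (X : 'M[C]_dY) : 'M[C]_(dX * dY * dZ) := (1%:M *t X) *t 1%:M.
transitivity (\sum_j T (demb D j *m adj (demb D j))).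
  by apply: eq_bigr => j _; rewrite ampl3_gram !adj1 !mulmx1 adjK.
rewrite -(big_morph T (_ : {morph T : X Y / X + Y}) (_ : T 0 = 0)) ?tot /T ?tens11 //.
  by move=> X Y; rewrite tensDr tensDl.
by rewrite tensmx0 tens0mx.
Qed.

Variables (p : 'I_(dk D) -> R) (muL : forall j, 'M[C]_(dX * dl D j)).
Variable (muR : forall j, 'M[C]_(dr D j * dZ)).
Hypotheses (p0 : forall j, 0 <= p j) (pL : forall j, psd (muL j)) (pR : forall j, psd (muR j)).

Let B j := (p j)%:C *: (muL j *t muR j).

Definition block_state : 'M[C]_(dX * dY * dZ) :=
  \sum_(j < dk D) (p j)%:C *:
    (@blockW R dX dY dZ D j
      *m castmx (tens_assoc_eq _ _ _ _, tens_assoc_eq _ _ _ _) (tensmx (muL j) (muR j))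
      *m adj (@blockW R dX dY dZ D j)).

Let psdB j : psd (B j). Proof. by apply: psdZ => //; apply: psd_tens. Qed.

Lemma block_stateE : block_state = \sum_j adj (block_proj j) *m B j *m block_proj j.
Proof.
by apply: eq_bigr => j _; rewrite blockW_proj /B -scalemxAr -scalemxAl.
Qed.

Lemma psd_block_state : psd block_state.
Proof.
rewrite block_stateE; apply: psd_sum => j _; rewrite -{2}[block_proj j]adjK.
exact: psd_conj.
Qed.

Lemma block_state_proj j : block_state *m adj (block_proj j) = adj (block_proj j) *m B j.
Proof.
rewrite block_stateE mulmx_suml (bigD1 j) //= big1 ?addr0 => [|i ij].
  by rewrite -mulmxA block_proj_diag mulmx1.
by rewrite -mulmxA block_proj_off // mulmx0.
Qed.

(** The logarithm is taken block by block through the intertwining relation, without an eigenbasis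
    of the direct sum. *)
Lemma logm_block_state_proj j : logm block_state *m adj (block_proj j) = adj (block_proj j) *m logm (B j).
Proof.
apply: cfun_intertwine; [exact: psd_herm psd_block_state|exact: psd_herm|exact: block_state_proj].
Qed.

Lemma tr_logm_block_state (X : 'M[C]_(dX * dY * dZ)) : Re (\tr (X *m logm block_state)) =
  \sum_j Re (\tr ((block_proj j *m X *m adj (block_proj j)) *m logm (B j))).
Proof.
rewrite -[logm block_state]mulmx1 -block_proj_sum mulmx_sumr mulmx_sumr Re_tr_sum.
apply: eq_bigr => j _; rewrite (mulmxA (logm _)) logm_block_state_proj !mulmxA mxtrace_mulC.
by rewrite !mulmxA.
Qed.

Lemma tr_block_proj_sum (X : 'M[C]_(dX * dY * dZ)) :
  \sum_j Re (\tr (block_proj j *m X *m adj (block_proj j))) = Re (\tr X).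
Proof.
rewrite -[X in RHS]mul1mx -block_proj_sum mulmx_suml Re_tr_sum; apply: eq_bigr => j _.
by rewrite mxtrace_mulC !mulmxA.
Qed.

Lemma supp_incl_block (X : 'M[C]_(dX * dY * dZ)) j V e k : supp_incl X block_state ->
  eigdec (B j) V e -> e 0 k = 0 -> diag_in V (block_proj j *m X *m adj (block_proj j)) k = 0.
Proof.
move=> sup h ek; have [v1 _ _] := h.
have : X *m (adj (block_proj j) *m col k V) = 0.
  apply: sup; rewrite mulmxA block_state_proj -mulmxA colE (mulmxA (B j)) (eigdec_mulr h).
  rewrite -mulmxA (_ : rdiag e *m _ = 0) ?mulmx0 //; apply/colP => i.
  by rewrite mul_diag_mx !mxE; case: eqP => [->|]; rewrite ?ek ?mul0r ?mulr0.
rewrite /diag_in diag_in_col => e0; rewrite -!mulmxA e0 !mulmx0 mxE //.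
Qed.

(** Only the diagonal blocks of [X] are controlled. Writing [X = Y Y^*] takes care of the others,
    since [adj Y] itself kills every block component of [v]. *)
Lemma supp_incl_blocks (X : 'M[C]_(dX * dY * dZ)) :
  psd X ->
  (forall j, exists V e, eigdec (B j) V e /\
     forall k, e 0 k = 0 -> diag_in V (block_proj j *m X *m adj (block_proj j)) k = 0) ->
  supp_incl X block_state.
Proof.
move=> /psd_sqrt[Y ->] h v mv.
suff : adj Y *m v = 0 by rewrite -mulmxA => ->; rewrite mulmx0.
rewrite -[v]mul1mx -block_proj_sum mulmx_suml mulmx_sumr big1 // => j _.
have [V [e [hV he]]] := h j.
have -> : adj Y *m (adj (block_proj j) *m block_proj j *m v) = adj (block_proj j *m Y) *m (block_proj j *m v).
  by rewrite adjM !mulmxA.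
apply: (block_supp hV) => [k /he|]; first by rewrite adjM !mulmxA.
have -> : B j *m (block_proj j *m v) = adj (block_state *m adj (block_proj j)) *m v.
  have hB : adj (B j) = B j by exact: psd_herm.
  by rewrite block_state_proj adjM adjK hB mulmxA.
by rewrite adjM adjK (psd_herm psd_block_state) -mulmxA mv mulmx0.
Qed.

End Decomp.

(** * Embedded states and their Kraus operators *)

Section Embedded.
Variables (dA dB dC : nat) (rho : 'M[C]_(dA * dB * dC)).
Hypothesis prho : psd rho.
Variables (dX dY dZ : nat).
Variables (VA : 'M[C]_(dX, dA)) (VB : 'M[C]_(dY, dB)) (VC : 'M[C]_(dZ, dC)).
Hypotheses (iA : is_isometry VA) (iB : is_isometry VB) (iC : is_isometry VC).

Lemma iso_emb : adj ((VA *t VB) *t VC) *m ((VA *t VB) *t VC) = 1%:M.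
Proof. by rewrite !adj_tens !tensmx_mul iA iB iC !tens11. Qed.

Lemma psd_emb3 : psd (emb3 VA VB VC rho).
Proof. exact: psd_conj. Qed.

Lemma vnent_emb3 : vnent (emb3 VA VB VC rho) = vnent rho.
Proof. exact: vnent_isom prho iso_emb. Qed.

Lemma tr_emb3 : \tr (emb3 VA VB VC rho) = \tr rho.
Proof. by rewrite /emb3 mxtrace_mulC mulmxA iso_emb mul1mx. Qed.

Variable D : decomp R dY.

Definition kraus j : 'M[C]_(dl D j * dr D j, dB) := adj (demb D j) *m VB.

Lemma kraus_sum : orth_decomp D -> \sum_j adj (kraus j) *m kraus j = 1%:M.
Proof.
move=> [_ [_ tot]]; rewrite -iB -[in RHS](mulmx1 (adj VB)) -tot mulmx_sumr mulmx_suml.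
by apply: eq_bigr => j _; rewrite adjM adjK !mulmxA.
Qed.

(** [VA] and [VC] factor out as isometries local to the two sides of the cut, so they do not affect
    the entropies of the marginals. *)
Lemma block_proj_emb3 j : block_proj dX dZ j *m emb3 VA VB VC rho *m adj (block_proj dX dZ j) =
  ((VA *t 1%:M) *t (1%:M *t VC)) *m sig rho (kraus j) *m
  adj ((VA *t 1%:M) *t (1%:M *t VC)).
Proof.
have e : block_proj dX dZ j *m ((VA *t VB) *t VC) =
    ((VA *t 1%:M) *t (1%:M *t VC)) *m ampl dA dC (kraus j).
  rewrite -ampl3_mul tens11 mul1mx /block_proj /ampl3 castmx_rowM !tensmx_mul !mul1mx.
  by [].
by rewrite /emb3 /sig !mulmxA e -!mulmxA -adjM e adjM !mulmxA.
Qed.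

Lemma cost_emb3 j : let S := block_proj dX dZ j *m emb3 VA VB VC rho *m adj (block_proj dX dZ j) in
  vnent (ptr_snd S) + vnent (ptr_fst S) + xlnx (Re (\tr S)) = cost rho (kraus j).
Proof.
rewrite /= block_proj_emb3 /cost; have pS := psd_sig prho (kraus j).
have i1 : adj (VA *t (1%:M : 'M_(dl D j))) *m (VA *t 1%:M) = 1%:M.
  by rewrite adj_tens adj1 tensmx_mul iA mulmx1 tens11.
have i2 : adj ((1%:M : 'M_(dr D j)) *t VC) *m (1%:M *t VC) = 1%:M.
  by rewrite adj_tens adj1 tensmx_mul iC mulmx1 tens11.
rewrite ptr_snd_conj ptr_fst_conj i1 i2 !tens11 !mul1mx !vnent_isom //.
- by rewrite mxtrace_mulC mulmxA adj_tens tensmx_mul i1 i2 tens11 mul1mx.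
- exact: psd_ptr_fst.
- exact: psd_ptr_snd.
Qed.

Lemma relent_emb3 (mu : 'M[C]_(dX * dY * dZ)) : supp_incl (emb3 VA VB VC rho) mu ->
  relent (emb3 VA VB VC rho) mu =
    (- vnent rho - Re (\tr (emb3 VA VB VC rho *m logm mu)))%:E.
Proof.
move=> sup; rewrite /relent; case: asboolP => // _; congr (_%:E).
by rewrite mulmxBr raddfB ReB -vnent_emb3 /vnent opprK.
Qed.

End Embedded.

Lemma relent_markov_ge dA dB dC dX dY dZ (rho : 'M[C]_(dA * dB * dC))
    (VA : 'M[C]_(dX, dA)) (VB : 'M[C]_(dY, dB)) (VC : 'M[C]_(dZ, dC))
    (mu : 'M[C]_(dX * dY * dZ)) (D : decomp R dY) :
  density rho -> is_isometry VA -> is_isometry VB -> is_isometry VC -> markov_wrt D mu ->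
  ((\sum_(j < dk D) cost rho (kraus VB j) - vnent rho)%:E <= relent (emb3 VA VB VC rho) mu)%E.
Proof.
move=> [prho trho] iA iB iC [oD [p [muL [muR [p0 [p1 [dL [dR emu]]]]]]]].
have [sup|nsup] := pselect (supp_incl (emb3 VA VB VC rho) mu); last first.
  by rewrite /relent; case: asboolP => // _; rewrite leey.
rewrite relent_emb3 // lee_fin [leLHS]addrC lerD2l.
rewrite -[mu]/(mu) in sup *; rewrite emu -/(block_state p muL muR) in sup *.
have pL j : psd (muL j) := (dL j).1.
have pR j : psd (muR j) := (dR j).1.
rewrite tr_logm_block_state //; set X := emb3 _ _ _ _ in sup *.
have pX : psd X by exact: psd_emb3.
have bound j : Re (\tr ((block_proj dX dZ j *m X *m adj (block_proj dX dZ j)) *m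
      logm ((p j)%:C *: (muL j *t muR j)))) <=
    p j - Re (\tr (block_proj dX dZ j *m X *m adj (block_proj dX dZ j))) - cost rho (kraus VB j).
  have [U [a hU]] := herm_eigdec (psd_herm (pL j)).
  have [W [c hW]] := herm_eigdec (psd_herm (pR j)).
  rewrite -(cost_emb3 prho VB iA iC).
  apply: (tr_log_product_le hU hW) => //; [exact: psd_conj| |exact: (dL j).2|exact: (dR j).2].
  move=> x y xy; have hB := eigdecZ (p j) (eigdec_tens hU hW).
  apply: (supp_incl_block oD sup hB).
  by rewrite !mxE mxtens_indexK.
(* Summed over the blocks, the terms [p_j] and [q_j] both give 1 and cancel. *)
have := ler_sum (index_enum _) (fun j (_ : true) => bound j).
rewrite !sumrB p1 (tr_block_proj_sum oD) tr_emb3 // trho subrr sub0r.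
by rewrite lerNr.
Qed.

Lemma density_gt0 n (A : 'M[C]_n) : density A -> (0 < n)%N.
Proof.
case: n A => // A [_]; rewrite /mxtrace big_ord0 => /eqP.
by rewrite eq_sym oner_eq0.
Qed.

Lemma density_exists n : (0 < n)%N -> exists A : 'M[C]_n, density A.
Proof.
move=> n0; exists ((n%:R^-1)%:C *: 1%:M); split.
  apply: psdZ; first by rewrite invr_ge0.
  by rewrite -[1%:M]mulmx1 -{2}adj1; apply: psd_adj.
rewrite linearZ /= mxtrace1 -[X in _ * X](rmorph_nat (real_complex R)) -rmorphM /=.
by rewrite mulVf // pnatr_eq0 -lt0n.
Qed.

Section Direct.
Variables (k b n : nat).

Definition inj_mx (j : 'I_k) : 'M[C]_(k * n, n) :=
  \matrix_(x, y) (x == mxtens_index (j, y))%:R.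

Lemma adj_inj_mul m j (A : 'M[C]_(k * n, m)) x y :
  (adj (inj_mx j) *m A) x y = A (mxtens_index (j, x)) y.
Proof.
rewrite mxE (bigD1 (mxtens_index (j, x))) //= big1 ?addr0 => [|z zx].
  by rewrite adjE mxE eqxx rmorph1 mul1r.
by rewrite adjE mxE (negPf zx) rmorph0 mul0r.
Qed.

Lemma inj_mul i j : adj (inj_mx i) *m inj_mx j = if i == j then 1%:M else 0.
Proof.
apply/matrixP => x y; rewrite adj_inj_mul mxE (can_eq (@mxtens_indexK _ _)) xpair_eqE.
by case: eqP => _; rewrite mxE.
Qed.

Lemma inj_sum : \sum_j inj_mx j *m adj (inj_mx j) = 1%:M.
Proof.
apply/matrixP => x x'; rewrite summxE [RHS]mxE.
transitivity (\sum_z (x == z)%:R * ((x' == z)%:R : C)).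
  rewrite sum_tens; apply: eq_bigr => j _; rewrite mxE; apply: eq_bigr => y _.
  by rewrite adjE !mxE rmorph_nat.
rewrite (bigD1 x) //= eqxx mul1r big1 ?addr0 => [|z zx]; first by rewrite eq_sym.
by rewrite eq_sym (negPf zx) mul0r.
Qed.

Variable M : 'I_k -> 'M[C]_(n, b).

(** Stinespring dilation of the family: an isometry as soon as the Gram matrices sum to 1. *)
Definition stack_mx : 'M[C]_(k * n, b) :=
  \matrix_(x, y) M (mxtens_unindex x).1 (mxtens_unindex x).2 y.

Lemma adj_inj_stack j : adj (inj_mx j) *m stack_mx = M j.
Proof. by apply/matrixP => x y; rewrite adj_inj_mul mxE mxtens_indexK. Qed.

Lemma stack_gram : adj stack_mx *m stack_mx = \sum_j adj (M j) *m M j.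
Proof.
rewrite -[X in _ *m X]mul1mx -inj_sum mulmx_suml mulmx_sumr; apply: eq_bigr => j _.
rewrite -[in RHS]adj_inj_stack adjM adjK -!mulmxA; congr (_ *m (_ *m _)).
Qed.
End Direct.

(** Embedding B by the stacked isometry and cutting along the direct summands returns the [M j] as
    Kraus operators; the Markov state built from the block weights and normalised marginals realises
    equality. *)
Lemma relent_markov_attain dA b dC k (rho : 'M[C]_(dA * b * dC)) (M : 'I_k -> 'M[C]_(b * b, b)) :
  density rho -> \sum_j adj (M j) *m M j = 1%:M ->
  exists (dB' : nat) (VB : 'M[C]_(dB', b)) (D : decomp R dB') (mu : 'M[C]_(dA * dB' * dC)),
  [/\ is_isometry VB, (dk D <= k)%N, (forall j, dl D j <= b /\ dr D j <= b)%N,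
      markov_wrt D mu &
      relent (emb3 (1%:M : 'M_dA) VB (1%:M : 'M_dC) rho) mu =
        (\sum_j cost rho (M j) - vnent rho)%:E].
Proof.
move=> drho eM; have [prho trho] := drho.
have : (0 < dA * b * dC)%N := density_gt0 drho.
rewrite !muln_gt0 -andbA => /and3P[A0 B0 C0].
(* The default states [oL] and [oR] fill the blocks of weight 0, which have no normalised
   marginals. *)
have [oL doL] : exists A : 'M[C]_(dA * b), density A.
  by apply: density_exists; rewrite muln_gt0 A0.
have [oR doR] : exists A : 'M[C]_(b * dC), density A.
  by apply: density_exists; rewrite muln_gt0 B0.
pose D := @Decomp R (k * (b * b)) k (fun _ => b) (fun _ => b) (@inj_mx k (b * b)).
pose VB := stack_mx M.
have iB : is_isometry VB by rewrite /is_isometry stack_gram.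
have i1 n : is_isometry (1%:M : 'M[C]_n) by rewrite /is_isometry adj1 mulmx1.
have oD : orth_decomp D.
  split; first by move=> j; rewrite /is_isometry inj_mul eqxx.
  split; last exact: inj_sum.
  by move=> i j ij; rewrite inj_mul (negPf ij).
pose X := emb3 (1%:M : 'M_dA) VB (1%:M : 'M_dC) rho.
have pX : psd X by exact: psd_emb3.
pose S j : 'M[C]_(dA * b * (b * dC)) := block_proj dA dC (j : 'I_(dk D)) *m X *m adj (block_proj dA dC (j : 'I_(dk D))).
have pS j : psd (S j) by exact: psd_conj.
pose q j := Re (\tr (S j)).
have q0 j : 0 <= q j by rewrite Re_ge0 // psd_tr.
have norm n (Y o : 'M[C]_n) (r : R) : density o -> psd Y -> \tr Y = r%:C -> 0 <= r ->
    exists m : 'M[C]_n, density m /\ Y = r%:C *: m.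
  move=> dO pY tY r0; have [rz|rn] := eqVneq r 0.
    by exists o; split=> //; rewrite rz scale0r; apply: psd_tr0 => //; rewrite tY rz.
  exists (r^-1%:C *: Y); split; last by rewrite scalerA -rmorphM divff // scale1r.
  split; first by apply: psdZ; rewrite ?invr_ge0.
  by rewrite linearZ /= tY -rmorphM mulVf.
have tS j : \tr (S j) = (q j)%:C by rewrite /q psd_re // psd_tr.
have exL j : exists m : 'M[C]_(dA * b), density m /\ ptr_snd (S j) = (q j)%:C *: m.
  by apply: (norm _ _ oL) => //; [exact: psd_ptr_snd|rewrite mxtrace_ptr_sndE].
have exR j : exists m : 'M[C]_(b * dC), density m /\ ptr_fst (S j) = (q j)%:C *: m.
  by apply: (norm _ _ oR) => //; [exact: psd_ptr_fst|rewrite mxtrace_ptr_fstE].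
have [muL hL] := choice exL; have [muR hR] := choice exR.
have pL j : psd (muL j) := (hL j).1.1.
have pR j : psd (muR j) := (hR j).1.1.
pose mu := @block_state dA (k * (b * b)) dC D q muL muR.
have marg j U a W c : eigdec (muL j) U a -> eigdec (muR j) W c -> _ :=
  fun hU hW => tr_log_marginals hU hW (pL j) (pR j) (pS j) (hL j).2 (hR j).2.
have sup : supp_incl X mu.
  apply: supp_incl_blocks => // j.
  have [U [a hU]] := herm_eigdec (psd_herm (pL j)).
  have [W [c hW]] := herm_eigdec (psd_herm (pR j)).
  exists (U *t W), (q j *: tens_row a c); split.
    exact: eigdecZ (eigdec_tens hU hW).
  move=> i; case: (mxtens_indexP i) => x y; rewrite !mxE mxtens_indexK /= => e0.
  exact: (marg _ _ _ _ _ hU hW).1.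
exists (k * (b * b))%N, VB, D, mu; split=> //.
  split=> //; exists q, muL, muR; split=> //; split.
    by rewrite (tr_block_proj_sum oD) tr_emb3 // trho.
  by split=> [j|]; [exact: (hL j).1|split=> // j; exact: (hR j).1].
rewrite relent_emb3 // (tr_logm_block_state oD) // addrC -sumrN; congr (_ - _)%:E.
apply: eq_bigr => j _.
have [U [a hU]] := herm_eigdec (psd_herm (pL j)).
have [W [c hW]] := herm_eigdec (psd_herm (pR j)).
rewrite (marg _ _ _ _ _ hU hW).2 opprK.
have := cost_emb3 prho VB (i1 dA) (i1 dC) (j : 'I_(dk D)).
by rewrite /= => ->; rewrite /kraus adj_inj_stack.
Qed.

End Markov.

(** * Compactness and continuity *)

Section Minimum.
Local Open Scope classical_set_scope.
Variable R : realType.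
Local Notation C := R[i].
Local Notation Re := (@complex.Re R).
Local Notation Im := (@complex.Im R).

(** The extreme value theorem on a closed subset of a cube, with closedness and continuity in
    epsilon form so that the applications need only norm estimates. *)
Lemma rV_min n (f : 'rV[R]_n -> R) (A : set 'rV[R]_n) :
  A !=set0 -> (forall x, A x -> forall i, `|x 0 i| <= 1) ->
  (forall x : 'rV[R]_n,
     (forall d, 0 < d -> exists y, A y /\ forall i, `|x 0 i - y 0 i| < d) -> A x) ->
  (forall x, A x -> forall e, 0 < e -> exists d, 0 < d /\
     forall y, A y -> (forall i, `|x 0 i - y 0 i| < d) -> `|f x - f y| < e) ->
  exists c, A c /\ forall t, A t -> f c <= f t.
Proof.
move=> A0 A1 Acl Af.
have cA : compact A.
  have cbox : compact [set v : 'rV[R]_n | forall i, `[(- 1 : R), 1]%classic (v ord0 i)].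
    by apply: (@rV_compact R _ (fun=> `[(- 1 : R), 1]%classic)) => _; exact: segment_compact.
  apply: subclosed_compact _ cbox _ => [x clx|x Ax i].
    apply: Acl => d d0; have [y [Ay [_ xy]]] := clx _ (nbhsx_ballx x d d0).
    by exists y; split=> // i; exact: (xy 0 i).
  by rewrite /= in_itv /= -ler_norml; exact: A1.
have [c] : exists2 c, c \in A & forall t, t \in A -> f c <= f t.
  apply: EVT_min_rV => //; apply/subspace_continuousP => x Ax.
  apply/cvgrPdist_lt => e e0; have [d [d0 hd]] := Af x Ax e e0.
  rewrite near_withinE; apply/nbhs_ballP; exists d => //= y [_ xy] Ay.
  by apply: hd => // i; exact: (xy 0 i).
rewrite inE => Ac hc; exists c; split=> // t At; apply: hc; exact/mem_set.
Qed.

Lemma normc_real (a : R) : `|a%:C : C| = `|a|%:C.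
Proof. by rewrite normc_def /= expr0n addr0 sqrtr_sqr. Qed.

Lemma normc_le_ReIm (z : C) : `|z| <= (`|Re z| + `|Im z|)%:C.
Proof.
rewrite {1}(complexE z) (le_trans (ler_normD _ _)) // rmorphD /= -!normc_real lerD2l.
rewrite normrM (_ : `|'i%C| = 1 :> C) ?mul1r //.
by rewrite normc_def /= expr0n expr1n add0r sqrtr1.
Qed.

Lemma normc_ge_Im (z : C) : `|Im z|%:C <= `|z|.
Proof.
rewrite normc_def lecR -sqrtr_sqr ler_sqrt ?addr_ge0 ?sqr_ge0 //.
by rewrite lerDr sqr_ge0.
Qed.

Lemma norm1_eq0 m n (A : 'M[C]_(m, n)) : (forall e, 0 < e -> norm1 A <= e%:C) -> A = 0.
Proof.
move=> h; apply/matrixP => i j; rewrite mxE; apply/eqP; rewrite -normr_le0.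
rewrite -(psd_re (normr_ge0 (A i j))) lecR leNgt; apply/negP => p.
have := le_trans (entry_norm1 A i j) (h (Re `|A i j| / 2) (divr_gt0 p (ltr0Sn _ _))).
by rewrite -[X in X <= _](psd_re (normr_ge0 (A i j))) lecR; lra.
Qed.

Lemma iso_norm1 m n (V : 'M[C]_(m, n)) : is_isometry V -> norm1 V <= (m * n)%:R.
Proof.
move=> iV; apply: (@le_trans _ _ (\sum_(i < m) \sum_(j < n) 1)).
  by apply: ler_sum => i _; apply: ler_sum => j _; exact: unitary_entry.
by rewrite !sumr_const !card_ord -mulrnA mulnC.
Qed.

Section Param.
Variables m n : nat.

Definition decode (x : 'rV[R]_(m * n + m * n)) : 'M[C]_(m, n) :=
  \matrix_(i, j) Complex (x 0 (lshift (m * n) (mxtens_index (i, j))))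
                         (x 0 (rshift (m * n) (mxtens_index (i, j)))).

Definition encode (V : 'M[C]_(m, n)) : 'rV[R]_(m * n + m * n) :=
  row_mx (\row_k Re (V (mxtens_unindex k).1 (mxtens_unindex k).2))
         (\row_k Im (V (mxtens_unindex k).1 (mxtens_unindex k).2)).

Lemma encodeK V : decode (encode V) = V.
Proof.
apply/matrixP => i j; rewrite !mxE !(unsplitK (inl _)) !(unsplitK (inr _)) !mxE !mxtens_indexK /=.
by case: (V i j).
Qed.

Lemma decode_close (x y : 'rV[R]_(m * n + m * n)) (d : R) : 0 < d ->
  (forall i, `|x 0 i - y 0 i| < d / (2 * (m * n).+1%:R)) ->
  norm1 (decode y - decode x) <= d%:C.
Proof.
move=> d0 h; set r := d / _ in h.
have r0 : 0 < r by rewrite divr_gt0 // mulr_gt0.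
apply: (@le_trans _ _ (\sum_(i < m) \sum_(j < n) (2 * r)%:C)).
  apply: ler_sum => i _; apply: ler_sum => j _; rewrite !mxE.
  apply: le_trans (normc_le_ReIm _) _; rewrite lecR /=.
  have h1 := h (lshift (m * n) (mxtens_index (i, j))).
  have h2 := h (rshift (m * n) (mxtens_index (i, j))).
  by rewrite distrC [`|x 0 (rshift _ _) - _|]distrC in h1 h2 *; lra.
rewrite !sumr_const !card_ord -mulrnA mulnC -rmorphMn lecR -mulr_natl /=.
apply: (@le_trans _ _ ((m * n).+1%:R * (2 * r))).
  by rewrite ler_pM2r ?mulr_gt0 // ler_nat.
have E (N : R) : 0 < N -> N * (2 * (d / (2 * N))) = d by move=> N0; field; rewrite gt_eqF.
by rewrite E.
Qed.

Lemma decode_bound x : is_isometry (decode x) -> forall i, `|x 0 i| <= 1.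
Proof.
move=> iV i; rewrite -lecR -[leRHS]/(1 : C).
have h a b : `|decode x a b| <= 1 by exact: unitary_entry.
rewrite -(splitK i); case: (split i) => k /=; case: (mxtens_indexP k) => a b.
  by apply: le_trans (h a b); apply: le_trans (normc_ge_Re _); rewrite mxE.
by apply: le_trans (h a b); apply: le_trans (normc_ge_Im _); rewrite mxE.
Qed.

Lemma decode_closed (x : 'rV[R]_(m * n + m * n)) :
  (forall d, 0 < d -> exists y, is_isometry (decode y) /\ forall i, `|x 0 i - y 0 i| < d) ->
  is_isometry (decode x).
Proof.
move=> h; set V := decode x.
(* This constant bounds [norm1 V + norm1 W] for every isometry [W], and thus the factor in the
   telescoped difference of [V^* V] and [W^* W]. *)
have c0 : 0 < 1 + Re (norm1 V) + (m * n)%:R :> R.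
  by rewrite ltr_pwDl ?ler0n // ltr_pwDl ?Re_ge0 // norm1_ge0.
apply/eqP; rewrite -subr_eq0; apply/eqP/norm1_eq0 => e e0.
set c := 1 + _ + _ in c0.
have [y [iy xy]] := h _ (divr_gt0 (divr_gt0 e0 c0)
   (mulr_gt0 (ltr0Sn R 1) (ltr0Sn R (m * n)))).
have le := decode_close (divr_gt0 e0 c0) xy; set W := decode y in iy le.
rewrite -iy (_ : _ - _ = adj V *m (V - W) + adj (V - W) *m W); last first.
  by rewrite adjD adjN mulmxBr mulmxBl addrA subrK.
have leN : norm1 (V - W) <= (e / c)%:C by rewrite -norm1N opprB.
apply: (le_trans (norm1D _ _)); apply: (le_trans (lerD (norm1M _ _) (norm1M _ _))).
rewrite !norm1_adj mulrC -mulrDr.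
have hs : norm1 V + norm1 W <= c%:C.
  rewrite /c !rmorphD /= psd_re ?norm1_ge0 // rmorph_nat lerD ?iso_norm1 //.
  by rewrite lerDr.
have nn : 0 <= norm1 V + norm1 W by rewrite addr_ge0 ?norm1_ge0.
apply: le_trans (ler_pM (norm1_ge0 _) nn leN hs) _.
by rewrite -rmorphM divfK ?gt_eqF.
Qed.

Lemma isometry_min (f : 'M[C]_(m, n) -> R) :
  (exists V : 'M[C]_(m, n), is_isometry V) ->
  (forall V e, is_isometry V -> 0 < e -> exists d, 0 < d /\
     forall W, is_isometry W -> norm1 (W - V) <= d%:C -> `|f V - f W| < e) ->
  exists V : 'M[C]_(m, n), is_isometry V /\ forall W, is_isometry W -> f V <= f W.
Proof.
move=> [V0 iV0] cf.
have [||||c [ic hc]] := @rV_min _ (fun x => f (decode x)) [set x | is_isometry (decode x)].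
- by exists (encode V0); rewrite /= encodeK.
- by move=> x /= ix; exact: decode_bound.
- by move=> x h; exact: decode_closed.
- move=> x /= ix e e0; have [d [d0 hd]] := cf _ _ ix e0.
  exists (d / (2 * (m * n).+1%:R)); split; first by rewrite divr_gt0 // mulr_gt0.
  by move=> y iy xy; apply: hd => //; exact: decode_close.
exists (decode c); split=> // W iW; rewrite -(encodeK W); apply: hc.
by rewrite /= encodeK.
Qed.
End Param.

End Minimum.

(** * Joint continuity of the cost and the minimum over isometries *)

Section Continuity.
Variable R : realType.
Local Notation C := R[i].
Local Notation Re := (@complex.Re R).

Lemma tr_norm1 n (A : 'M[C]_n) : `|\tr A| <= norm1 A.
Proof.
apply: le_trans (ler_norm_sum _ _ _) _; apply: ler_sum => i _.
by rewrite (bigD1 i) //= lerDl; apply: sumr_ge0.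
Qed.

(** Makes the modulus of continuity of [xlnx] the case of dimension 1 of [vnent_modulus]. *)
Lemma xlnx_vnent (q : R) : xlnx q = - vnent (q%:C%:M : 'M[C]_1).
Proof.
have h : eigdec (q%:C%:M : 'M[C]_1) 1%:M (const_mx q).
  split; rewrite ?adj1 ?mulmx1 ?mul1mx //.
  by apply/matrixP => i j; rewrite !mxE !ord1.
by rewrite (vnent_eig h) big_ord1 mxE opprK.
Qed.

Lemma xlnx_modulus (e : R) : 0 < e -> exists d : R, 0 < d /\
  forall q q' : R, 0 <= q -> 0 <= q' -> q' <= 1 -> `|q - q'| <= d -> xlnx q' <= xlnx q + e.
Proof.
move=> e0; have [d [d0 h]] := vnent_modulus 1 e0; exists d; split=> // q q' q0 q0' q1 qq.
have ps (r : R) : 0 <= r -> psd (r%:C%:M : 'M[C]_1).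
  move=> r0; rewrite -scalemx1; apply: psdZ => //.
  by rewrite -[1%:M]mulmx1 -{2}adj1; apply: psd_adj.
have t1 : Re (\tr (q'%:C%:M : 'M[C]_1)) <= 1 by rewrite mxtrace_scalar mulr1n.
have hd : norm1 (q%:C%:M - q'%:C%:M : 'M[C]_1) <= d%:C.
  by rewrite -raddfB /= -rmorphB /norm1 !big_ord1 mxE mulr1n normc_real lecR.
have := h _ _ (ps _ q0') (ps _ q0) t1 hd.
rewrite (xlnx_vnent q) (xlnx_vnent q'); move: (vnent _) (vnent _) => x y; lra.
Qed.

Section Modulus.
Variables (dA b dC : nat).
Implicit Types rho : 'M[C]_(dA * b * dC).

(** One third of [e] for each term of the cost. The bound is one-sided, but its radius depends on
    neither state nor Kraus operator, so it can be applied in both directions. *)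
Lemma cost_modulus l r (e : R) : 0 < e -> exists d : R, 0 < d /\
  forall rho rho' (M M' : 'M[C]_(l * r, b)), psd rho -> psd rho' ->
  Re (\tr (sig rho M)) <= 1 -> Re (\tr (sig rho' M')) <= 1 ->
  norm1 (sig rho' M' - sig rho M) <= d%:C -> cost rho' M' <= cost rho M + e.
Proof.
move=> e0; have e3 : 0 < e / 3 by lra.
have [d2 [d2p h2]] := vnent_modulus (dA * l) e3.
have [d1 [d1p h1]] := vnent_modulus (r * dC) e3.
have [d0 [d0p h0]] := xlnx_modulus e3.
exists (Num.min d2 (Num.min d1 d0)); split; first by rewrite !lt_min d2p d1p d0p.
move=> rho rho' M M' pr pr' t1 t1' close; rewrite /cost.
have pS := psd_sig pr M; have pS' := psd_sig pr' M'.
set S := sig rho M in t1 close pS *; set S' := sig rho' M' in t1' close pS' *.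
have [c2 [c1 c0]] : norm1 (S' - S) <= d2%:C /\ norm1 (S' - S) <= d1%:C /\ norm1 (S' - S) <= d0%:C.
  by split; [|split]; apply: (le_trans close); rewrite lecR !ge_min lexx ?orbT.
have t2 : Re (\tr (ptr_snd S)) <= 1 by rewrite mxtrace_ptr_sndE; exact: t1.
have t1r : Re (\tr (ptr_fst S)) <= 1 by rewrite mxtrace_ptr_fstE; exact: t1.
have c2' : norm1 (ptr_snd S' - ptr_snd S) <= d2%:C.
  apply: le_trans c2; have -> : ptr_snd S' - ptr_snd S = ptr_snd (S' - S); last exact: norm1_ptr_snd.
  by rewrite ptr_sndD -(scaleN1r S) ptr_sndZ scaleN1r.
have c1' : norm1 (ptr_fst S' - ptr_fst S) <= d1%:C.
  apply: le_trans c1; have -> : ptr_fst S' - ptr_fst S = ptr_fst (S' - S); last exact: norm1_ptr_fst.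
  by rewrite ptr_fstD -(scaleN1r S) ptr_fstZ scaleN1r.
have a2 := h2 _ _ (psd_ptr_snd pS) (psd_ptr_snd pS') t2 c2'.
have a1 := h1 _ _ (psd_ptr_fst pS) (psd_ptr_fst pS') t1r c1'.
have c0' : `|Re (\tr S) - Re (\tr S')| <= d0.
  rewrite -lecR -ReB -raddfB; apply: le_trans (normc_ge_Re _) _.
  by apply: le_trans (tr_norm1 _) _; rewrite -norm1N opprB.
have a0 := h0 _ _ (Re_ge0 (psd_tr pS)) (Re_ge0 (psd_tr pS')) t1' c0'.
apply: le_trans (lerD (lerD a2 a1) a0) _.
by rewrite le_eqVlt; apply/orP; left; apply/eqP; field.
Qed.

Lemma norm1_1 n : norm1 (1%:M : 'M[C]_n) = n%:R.
Proof.
rewrite /norm1 (eq_bigr (fun=> 1)) => [|i _]; first by rewrite sumr_const card_ord.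
rewrite (bigD1 i) //= mxE eqxx normr1 big1 ?addr0 // => j ji.
by rewrite mxE eq_sym (negPf ji) normr0.
Qed.

Lemma norm1_ampl l r (M : 'M[C]_(l * r, b)) : norm1 (ampl dA dC M) = (dA * dC)%:R * norm1 M.
Proof.
have cc m m' n (e : m = m') (A : 'M[C]_(m, n)) : norm1 (castmx (e, erefl) A) = norm1 A.
  by case: m' / e.
by rewrite /ampl /ampl3 cc !norm1_tens !norm1_1 natrM; ring.
Qed.

Lemma amplB l r (M M' : 'M[C]_(l * r, b)) :
  ampl dA dC (M' - M) = ampl dA dC M' - ampl dA dC M.
Proof.
have D (X Y : 'M[C]_(l * r, b)) : ampl dA dC (X + Y) = ampl dA dC X + ampl dA dC Y.
  by rewrite /ampl /ampl3 tensDr tensDl; apply/matrixP => i j; rewrite [RHS]mxE !castmxE mxE.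
by rewrite D -(scaleN1r M) amplZ scaleN1r.
Qed.

Lemma sig_lipschitz l r (K L : R) : 0 <= K -> 0 <= L -> exists c : R, 0 < c /\
  forall rho rho' (M M' : 'M[C]_(l * r, b)), norm1 rho <= K%:C -> norm1 rho' <= K%:C ->
  norm1 M <= L%:C -> norm1 M' <= L%:C ->
  norm1 (sig rho' M' - sig rho M) <= c%:C * (norm1 (M' - M) + norm1 (rho' - rho)).
Proof.
(* [N] is the factor lost by amplification. After telescoping, the two outer differences contribute
   [c1] each and the middle one [c2]; the summand 1 makes the constant positive. *)
move=> K0 L0; pose N : R := (dA * dC)%:R; have N0 : 0 <= N by rewrite ler0n.
pose c1 := N * L * K * N; pose c2 := N * L * (N * L).
have c10 : 0 <= c1 by rewrite !mulr_ge0.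
have c20 : 0 <= c2 by rewrite !mulr_ge0.
exists (1 + (2 * c1 + c2)); split; first by lra.
move=> rho rho' M M' hr hr' hM hM'; rewrite /sig.
set A := ampl dA dC M; set A' := ampl dA dC M'.
have NC : (dA * dC)%:R = N%:C :> C by rewrite /N rmorph_nat.
have hA : norm1 A <= (N * L)%:C by rewrite norm1_ampl NC rmorphM ler_wpM2l // ler0c.
have hA' : norm1 A' <= (N * L)%:C by rewrite norm1_ampl NC rmorphM ler_wpM2l // ler0c.
have hD : norm1 (A' - A) = N%:C * norm1 (M' - M) by rewrite -amplB norm1_ampl NC.
have -> : A' *m rho' *m adj A' - A *m rho *m adj A =
    (A' - A) *m rho' *m adj A' + A *m (rho' - rho) *m adj A' + A *m rho *m adj (A' - A).
  by rewrite adjD adjN !mulmxBl mulmxBr mulmxBl mulmxDr mulmxN !addrA !subrK.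
set x := norm1 (M' - M); set y := norm1 (rho' - rho).
have x0 : 0 <= x by exact: norm1_ge0. have y0 : 0 <= y by exact: norm1_ge0.
have nn m n (Z : 'M[C]_(m, n)) : 0 <= norm1 Z by exact: norm1_ge0.
have N0c : 0 <= N%:C by rewrite ler0c.
have b1 : norm1 ((A' - A) *m rho' *m adj A') <= (N%:C * x) * K%:C * (N * L)%:C.
  apply: le_trans (norm1M _ _) _; rewrite norm1_adj ler_pM //.
  by apply: le_trans (norm1M _ _) _; rewrite hD ler_wpM2l // mulr_ge0.
have b2 : norm1 (A *m (rho' - rho) *m adj A') <= (N * L)%:C * y * (N * L)%:C.
  apply: le_trans (norm1M _ _) _; rewrite norm1_adj ler_pM //.
  by apply: le_trans (norm1M _ _) _; apply: ler_wpM2r; [exact: y0|exact: hA].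
have b3 : norm1 (A *m rho *m adj (A' - A)) <= (N * L)%:C * K%:C * (N%:C * x).
  apply: le_trans (norm1M _ _) _; rewrite norm1_adj hD.
  apply: ler_pM; [exact: nn|exact: mulr_ge0| |by []].
  by apply: le_trans (norm1M _ _) _; apply: ler_pM; [exact: nn|exact: nn|exact: hA|exact: hr].
apply: le_trans (norm1D _ _) _; apply: le_trans (lerD (le_trans (norm1D _ _) (lerD b1 b2)) b3) _.
rewrite /c1 /c2 !(rmorphD, rmorphM) /= rmorph1.
rewrite -subr_ge0.
have k0 : 0 <= K%:C :> C by rewrite ler0c.
have l0 : 0 <= L%:C :> C by rewrite ler0c.
rewrite [X in 0 <= X](_ : _ = x + y + (N%:C * L%:C * (N%:C * L%:C)) * x
   + (N%:C * L%:C * K%:C * N%:C) * y + (N%:C * L%:C * K%:C * N%:C) * y); last first.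
  by ring.
by rewrite !addr_ge0 ?mulr_ge0.
Qed.
End Modulus.

Lemma real_close (x y e : R) : 0 < e -> y <= x + e / 2 -> x <= y + e / 2 -> `|x - y| < e.
Proof. by move=> e0 h1 h2; rewrite ltr_distl; apply/andP; split; lra. Qed.

(** Here [x] and [x0] are the minima at rho and rho0, [y] and [y0] the values obtained by exchanging
    the two minimisers, [v] and [v0] the entropies. *)
Lemma real_sandwich (x0 y0 x y v v0 e : R) : 0 < e ->
  y <= x0 + e / 4 -> x <= y -> v0 <= v + e / 4 ->
  y0 <= x + e / 4 -> x0 <= y0 -> v <= v0 + e / 4 ->
  x0 - v0 - e < x - v < x0 - v0 + e.
Proof. by move=> *; apply/andP; split; lra. Qed.

Section Objective.
Variables (dA b dC : nat).
Implicit Types rho : 'M[C]_(dA * b * dC).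
(** The fixed target space: [b ^ 2] blocks of dimension [b * b]. *)
Let N := (b ^ 2 * (b * b))%N.

Definition slice (V : 'M[C]_(N, b)) (j : 'I_(b ^ 2)) : 'M[C]_(b * b, b) :=
  adj (inj_mx R (b * b) j) *m V.

Definition total rho (V : 'M[C]_(N, b)) : R := \sum_j cost rho (slice V j).

Lemma norm1_slice V j : norm1 (slice V j) <= norm1 V.
Proof.
rewrite [leRHS]/norm1 sum_tens (bigD1 j) //= -[leLHS]addr0 lerD //.
  by rewrite le_eqVlt; apply/orP; left; apply/eqP; apply: eq_bigr => x _;
     apply: eq_bigr => y _; rewrite adj_inj_mul.
by apply: sumr_ge0 => i _; apply: sumr_ge0 => x _; apply: sumr_ge0.
Qed.

Lemma sliceB V W j : slice (V - W) j = slice V j - slice W j.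
Proof. exact: mulmxBr. Qed.

Lemma slice_sum V : is_isometry V -> \sum_j adj (slice V j) *m slice V j = 1%:M.
Proof.
move=> iV; rewrite -[RHS]iV -[X in _ = _ *m X]mul1mx -inj_sum mulmx_suml mulmx_sumr.
by apply: eq_bigr => j _; rewrite /slice adjM adjK !mulmxA.
Qed.

Lemma tr_slice_le1 rho V j : density rho -> is_isometry V ->
  Re (\tr (sig rho (slice V j))) <= 1.
Proof.
move=> [prho trho] iV.
have s0 i : 0 <= Re (\tr (sig rho (slice V i))) by rewrite Re_ge0 // psd_tr //; apply: psd_sig.
have -> : 1 = \sum_i Re (\tr (sig rho (slice V i))).
  pose T (X : 'M[C]_b) : 'M[C]_(dA * b * dC) := ((1%:M *t X) *t 1%:M) *m rho.
  transitivity (Re (\tr (\sum_i T (adj (slice V i) *m slice V i)))).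
    rewrite -(big_morph T (_ : {morph T : X Y / X + Y}) (_ : T 0 = 0)).
    - by rewrite slice_sum // /T !tens11 mul1mx trho.
    - by move=> X Y; rewrite /T tensDr tensDl mulmxDl.
    - by rewrite /T tensmx0 tens0mx mul0mx.
  by rewrite Re_tr_sum; apply: eq_bigr => i _; rewrite mxtrace_sig.
by rewrite (bigD1 j) //= lerDl sumr_ge0.
Qed.

(** The radius does not depend on the isometries, which allows minima at different states to be
    compared. With [W = V] only rho moves, with [rho = rho0] only the isometry. *)
Lemma total_modulus rho0 (e : R) : density rho0 -> 0 < e -> exists d : R, 0 < d /\
  forall rho V W, density rho -> is_isometry V -> is_isometry W ->
  norm1 (W - V) + norm1 (rho - rho0) <= d%:C ->
  total rho W <= total rho0 V + e /\ total rho0 V <= total rho W + e.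
Proof.
move=> drho0 e0.
pose K := Re (norm1 rho0) + 1; have K0 : 0 <= K by rewrite addr_ge0 // Re_ge0 // norm1_ge0.
pose L : R := (N * b)%:R; have L0 : 0 <= L by rewrite ler0n.
have [c [c0 hc]] := @sig_lipschitz dA b dC b b K L K0 L0.
have k0 : 0 < (b ^ 2).+1%:R :> R by rewrite ltr0n.
have [d1 [d10 h1]] := @cost_modulus dA b dC b b _ (divr_gt0 e0 k0).
(* The bound 1 keeps [norm1 rho] below [K], so that the Lipschitz constant of [sig] applies. *)
exists (Num.min 1 (d1 / c)); split; first by rewrite lt_min ltr01 divr_gt0.
move=> rho V W drho iV iW close.
have dV : 0 <= norm1 (W - V) by exact: norm1_ge0.
have dr : 0 <= norm1 (rho - rho0) by exact: norm1_ge0.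
have c1 : norm1 (W - V) + norm1 (rho - rho0) <= 1%:C.
  by apply: (le_trans close); rewrite lecR ge_min lexx.
have c2 : norm1 (W - V) + norm1 (rho - rho0) <= (d1 / c)%:C.
  by apply: (le_trans close); rewrite lecR ge_min lexx orbT.
have KE : K%:C = norm1 rho0 + 1 by rewrite /K rmorphD rmorph1 /= psd_re // norm1_ge0.
have hr0 : norm1 rho0 <= K%:C by rewrite KE lerDl ler01.
have hr : norm1 rho <= K%:C.
  rewrite KE -{1}(subrK rho0 rho) addrC; apply: le_trans (norm1D _ _) _.
  rewrite lerD2l; apply: le_trans c1; exact: ler_wpDl.
have LE : L%:C = (N * b)%:R by rewrite /L rmorph_nat.
have hL U j : is_isometry U -> norm1 (slice U j) <= L%:C.
  by move=> iU; apply: le_trans (norm1_slice _ _) _; rewrite LE; exact: iso_norm1.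
have sum_le (f g : 'I_(b ^ 2) -> R) : (forall j, f j <= g j + e / (b ^ 2).+1%:R) ->
    \sum_j f j <= \sum_j g j + e.
  move=> h; apply: le_trans (ler_sum _ (fun j _ => h j)) _.
  rewrite big_split /= lerD2l sumr_const card_ord -[_ *+ _]mulr_natr mulrAC ler_pdivrMr //.
  by rewrite ler_pM2l // ler_nat.
have sc j : norm1 (sig rho (slice W j) - sig rho0 (slice V j)) <= d1%:C.
  apply: le_trans (hc _ _ _ _ hr0 hr (hL _ j iV) (hL _ j iW)) _.
  have -> : d1 = c * (d1 / c) by rewrite mulrCA divff ?mulr1 // gt_eqF.
  rewrite rmorphM; apply: ler_wpM2l; first by rewrite ler0c ltW.
  apply: le_trans c2.
  by rewrite lerD2r -sliceB norm1_slice.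
have [pr _] := drho; have [pr0 _] := drho0.
have tV j := tr_slice_le1 j drho0 iV; have tW j := tr_slice_le1 j drho iW.
split; apply: sum_le => j.
  exact: h1 pr0 pr (tV j) (tW j) (sc j).
apply: h1 pr pr0 (tW j) (tV j) _.
by rewrite -opprB norm1N.
Qed.

Lemma total_min rho : density rho ->
  exists V, is_isometry V /\ forall W, is_isometry W -> total rho V <= total rho W.
Proof.
move=> drho; apply: isometry_min.
  exists (pid_mx b); apply: pid_isom; rewrite /N expnS expn1.
  by case: (b) => // n; rewrite -[leqLHS]mul1n leq_mul // leq_pmulr.
move=> V e iV e0; have e2 : 0 < e / 2 by lra.
have [d [d0 h]] := total_modulus drho e2; exists d; split=> // W iW close.
have [a1 a2] : total rho W <= total rho V + e / 2 /\ total rho V <= total rho W + e / 2.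
  apply: h => //.
  by rewrite subrr (_ : norm1 0 = 0) ?addr0 // /norm1 big1 // => i _; rewrite big1 // => j _; rewrite mxE normr0.
exact: real_close e0 a1 a2.
Qed.

(** The minimiser is realised by a Markov state. Conversely, the Kraus family of any competitor
    reduces to [b ^ 2] blocks of size [b * b], which stack to an isometry that [V] beats. *)
Lemma Delta_total rho V : density rho -> is_isometry V ->
  (forall W, is_isometry W -> total rho V <= total rho W) ->
  Delta rho = (total rho V - vnent rho)%:E.
Proof.
move=> drho iV minV; have [prho _] := drho.
have : (0 < dA * b * dC)%N := density_gt0 drho.
rewrite !muln_gt0 -andbA => /and3P[_ b0 _].
apply/eqP; rewrite eq_le; apply/andP; split.
  have [dB' [VB [D [mu [iB _ _ mk rel]]]]] := relent_markov_attain drho (slice_sum iV).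
  apply: ereal_inf_lbound; exists dA, dB', dC, 1%:M, VB, 1%:M, mu.
  split=> //; [by rewrite /is_isometry adj1 mulmx1|by rewrite /is_isometry adj1 mulmx1|by exists D].
apply: le_ereal_inf_tmp => _ [dX [dY [dZ [VA [VB [VC [mu [iA iB iC [D mk] ->]]]]]]]].
apply: le_trans (relent_markov_ge drho iA iB iC mk); rewrite lee_fin lerD2r.
have [oD _] := mk.
have [M [eM leM]] := family_reduce prho b0 (fun j : 'I_(dk D) => kraus VB j).
rewrite (kraus_sum iB oD) in eM; apply: le_trans leM.
have iM : is_isometry (stack_mx M) by rewrite /is_isometry stack_gram.
apply: le_trans (minV _ iM) _; rewrite le_eqVlt; apply/orP; left; apply/eqP.
by apply: eq_bigr => j _; rewrite /slice adj_inj_stack.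
Qed.

End Objective.
End Continuity.

Theorem theorem2 (R : realType) (dA dB dC : nat) :
  (forall rho : 'M[R[i]]_(dA * dB * dC), density rho ->
     exists (dB' : nat) (VB : 'M[R[i]]_(dB', dB)) (D : decomp R dB')
            (mu : 'M[R[i]]_(dA * dB' * dC)),
       [/\ is_isometry VB,
           (dk D <= dB ^ 2)%N,
           (forall j, dl D j <= dB /\ dr D j <= dB)%N,
           markov_wrt D mu &
           relent (emb3 (1%:M : 'M[R[i]]_dA) VB (1%:M : 'M[R[i]]_dC) rho) mu
             = Delta rho])
  /\
  (forall rho0 : 'M[R[i]]_(dA * dB * dC), density rho0 ->
     forall e : R, 0 < e -> exists d : R, 0 < d /\
       forall rho : 'M[R[i]]_(dA * dB * dC), density rho ->
         (forall i j, `|rho i j - rho0 i j| < d%:C) ->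
         (Delta rho0 - e%:E < Delta rho < Delta rho0 + e%:E)%E).
Proof.
split=> [rho drho|rho0 drho0 e e0].
  have [V [iV minV]] := total_min drho.
  rewrite (Delta_total drho iV minV).
  exact: relent_markov_attain drho (slice_sum iV).
have e4 : 0 < e / 4 by lra.
have [d1 [d10 h1]] := total_modulus drho0 e4.
have [d2 [d20 h2]] := vnent_modulus (dA * dB * dC) e4.
set n := (dA * dB * dC)%N in d1 d2 d10 d20 h1 h2 *.
have n0 : 0 < (n * n).+1%:R :> R by rewrite ltr0n.
exists (Num.min d1 d2 / (n * n).+1%:R); split; first by rewrite divr_gt0 // lt_min d10.
move=> rho drho close.
have cl : norm1 (rho - rho0) <= (Num.min d1 d2)%:C.
  apply: (@le_trans _ _ (\sum_(i < n) \sum_(j < n) (Num.min d1 d2 / (n * n).+1%:R)%:C)).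
    by apply: ler_sum => i _; apply: ler_sum => j _; rewrite !mxE ltW.
  rewrite !sumr_const !card_ord -mulrnA -rmorphMn lecR -mulr_natr mulrAC ler_pdivrMr //.
  by rewrite ler_pM2l ?lt_min ?d10 // ler_nat.
have c1 : norm1 (rho - rho0) <= d1%:C by apply: (le_trans cl); rewrite lecR ge_min lexx.
have c2 : norm1 (rho - rho0) <= d2%:C by apply: (le_trans cl); rewrite lecR ge_min lexx orbT.
have [V0 [iV0 min0]] := total_min drho0; have [V [iV minV]] := total_min drho.
rewrite (Delta_total drho0 iV0 min0) (Delta_total drho iV minV).
have nz : norm1 (0 : 'M[R[i]]_(dB ^ 2 * (dB * dB), dB)) = 0.
  by rewrite /norm1 big1 // => i _; rewrite big1 // => j _; rewrite mxE normr0.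
(* Each minimiser is tested at the other state. In either direction this costs [e / 4], and the
   entropy another [e / 4], which leaves the strict inequality. *)
have [a1 _] : total rho V0 <= total rho0 V0 + e / 4 /\ total rho0 V0 <= total rho V0 + e / 4.
  by apply: h1 => //; rewrite subrr nz add0r.
have [_ a2] : total rho V <= total rho0 V + e / 4 /\ total rho0 V <= total rho V + e / 4.
  by apply: h1 => //; rewrite subrr nz add0r.
have b1 := minV _ iV0; have b2 := min0 _ iV.
have [p t1] := drho; have [p0 t0] := drho0.
have v1 : vnent rho <= vnent rho0 + e / 4 by apply: h2 => //; rewrite t0.
have v2 : vnent rho0 <= vnent rho + e / 4.
  by apply: h2 => //; rewrite ?t1 // -opprB norm1N.
rewrite -EFinB -EFinD !lte_fin; exact: real_sandwich e0 a1 b1 v2 a2 b2 v1.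
Qed.
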